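(* Let $\mathfrak o$ be a compact discrete valuation ring with residue field of cardinality $q$. For $C\subseteq[n]$ put $C^*=\{n-i+1:i\in C\}$, $x_C$-notation as below. Then, as formal power series, \[ \mathsf{HS}_{n,\mathfrak o}(\mathbf x,\mathbf y)=\mathsf{HLS}_n\Bigl(q^{-1},\bigl(q^{\sigma_n(C)}\,x_{\#C}\,\mathbf y_{C^*}\bigr)_{\varnothing\neq C\subseteq[n]}\Bigr). \]
   Context: Hall–Littlewood–Schubert series: Let $[n]=\{1,\dots,n\}$. $\mathrm{SSYT}_n$ is the set of semistandard Young tableaux with entries in $[n]$ (including the empty one); a tableau is identified with its sequence of columns $(C_1,\dots,C_\ell)$, $C_j\subseteq[n]$ the set of entries of column $j$, and $T_{ij}$ is the entry in row $i$, column $j$. $T$ is reduced if its columns are pairwise distinct; $\mathrm{rSSYT}_n$ is the finite set of reduced tableaux. For cells $(i,j),(i,j+1)$ both in $T$, $\mathrm{Leg}^+_T(i,j)=C_j\cap\{T_{ij},\dots,T_{i,j+1}\}$ if $T_{i,j+1}\notin C_j$, else $\varnothing$ ($\varnothing$ if a cell is missing). $\Phi_T(Y)=\prod_{\mathrm{Leg}^+_T(i,j)\neq\varnothing}(1-Y^{\#\mathrm{Leg}^+_T(i,j)})$. For variables $\mathbf X=(X_C)_{\varnothing\ne C\subseteq[n]}$, $\mathsf{HLS}_n(Y,\mathbf X)=\sum_{T\in\mathrm{rSSYT}_n}\Phi_T(Y)\prod_{C\in T}\frac{X_C}{1-X_C}$; $\mathsf{HLS}_n(Y,(f_C)_C)$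 denotes the substitution $X_C\mapsto f_C$. Schubert dimension: $\sigma_n(C)=\sum_{i\in[n]\setminus C}i-\binom{n-\#C+1}{2}$. $\mathfrak o$ has maximal ideal $\mathfrak p$ and valuation $v_{\mathfrak p}$. For a lattice (finite-index submodule) $\Lambda\le\mathfrak o^n$, $\lambda(\Lambda)$ is the partition with $\mathfrak o^n/\Lambda\cong\bigoplus_i\mathfrak o/\mathfrak p^{\lambda_i}$, and $\mathrm{inc}(\lambda)=(\lambda_1-\lambda_2,\dots,\lambda_{n-1}-\lambda_n,\lambda_n)$. The Hermite composition $\delta(\Lambda)=(\delta_1,\dots,\delta_n)\in\mathbb N_0^n$ is the vector of valuations of the diagonal entries of any upper-triangular matrix in $\mathrm{Mat}_n(\mathfrak o)$ whose rows (as coordinate vectors in the standard basis) generate $\Lambda$; it is independent of the choice. With variables $\mathbf x=(x_1,\dots,x_n)$, $\mathbf y=(y_1,\dots,y_n)$, monomials $\mathbf x^{a}=\prod x_i^{a_i}$, $\mathbf y_C=\prod_{i\in C}y_i$, the Hermite–Smith series is $\mathsf{HS}_{n,\mathfrak o}(\mathbf x,\mathbf y)=\sum_{\Lambda\le\mathfrak o^n}\mathbf x^{\mathrm{inc}(\lambda(\Lambda))}\mathbf y^{\delta(\Lambda)}$. *)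

(* Defs.v *)
From HB Require Import structures.
From mathcomp Require Import all_boot all_order all_algebra.
From Stdlib Require List.
Set Implicit Arguments. Unset Strict Implicit. Unset Printing Implicit Defensive.
Import Order.TTheory GRing.Theory Num.Theory.

Local Open Scope ring_scope.

Definition divR (R : comPzRingType) (x y : R) : Prop := exists r : R, y = x * r.

Definition is_DVR (R : idomainType) (pi : R) : Prop :=
  [/\ pi != 0, pi \isn't a GRing.unit &
      forall x : R, x != 0 ->
        exists (k : nat) (u : R), u \is a GRing.unit /\ x = u * pi ^+ k].

Definition pi_complete (R : idomainType) (pi : R) : Prop :=
  forall s : nat -> R, (forall k, divR (pi ^+ k) (s k.+1 - s k)) ->
    exists x : R, forall k, divR (pi ^+ k) (x - s k).

(** compact DVR = complete DVR with finite residue field *)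
Definition compact_DVR (R : idomainType) (pi : R) : Prop :=
  is_DVR pi /\ pi_complete pi.

Definition residue_card (R : idomainType) (pi : R) (q : nat) : Prop :=
  exists reps : seq R,
    [/\ size reps = q,
        (forall i j, (i < q)%N -> (j < q)%N -> i <> j ->
            ~ divR pi (nth 0 reps i - nth 0 reps j)) &
        forall x : R, exists i, (i < q)%N /\ divR pi (x - nth 0 reps i)].

Definition hasval (R : idomainType) (pi : R) (x : R) (k : nat) : Prop :=
  exists u : R, u \is a GRing.unit /\ x = u * pi ^+ k.

Definition is_lattice (R : idomainType) (n : nat) (L : 'rV[R]_n -> Prop) : Prop :=
  [/\ L 0, (forall u v, L u -> L v -> L (u + v)),
      (forall (r : R) u, L u -> L (r *: u)) &
      exists s : seq 'rV[R]_n, forall v, exists w, w \in s /\ L (v - w)].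

Definition diag_sub (R : idomainType) (pi : R) (n : nat) (lam : 'I_n -> nat)
  (u : 'rV[R]_n) : Prop := forall i : 'I_n, divR (pi ^+ lam i) (u 0 i).

(** o^n / L is isomorphic to (+)_i o/p^{lam_i}.  An o-module homomorphism
    o^n/L -> o^n/D is induced by an o-linear map o^n -> o^n, i.e. a matrix G,
    with G(L) in D; it is injective iff G^{-1}(D) is in L and surjective iff
    G(o^n) + D = o^n. *)
Definition quot_iso_type (R : idomainType) (pi : R) (n : nat)
  (L : 'rV[R]_n -> Prop) (lam : 'I_n -> nat) : Prop :=
  exists G : 'M[R]_n,
    (forall v, L v <-> diag_sub pi lam (v *m G)) /\
    (forall w, exists v, diag_sub pi lam (w - v *m G)).

Definition is_partition (n : nat) (lam : 'I_n -> nat) : Prop :=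
  forall i j : 'I_n, (i <= j)%N -> (lam j <= lam i)%N.

Definition elem_type (R : idomainType) (pi : R) (n : nat)
  (L : 'rV[R]_n -> Prop) (lam : 'I_n -> nat) : Prop :=
  is_partition lam /\ quot_iso_type pi L lam.

Definition getn (n : nat) (lam : 'I_n -> nat) (k : nat) : nat :=
  if insub k is Some i then lam i else 0%N.

Definition inc (n : nat) (lam : 'I_n -> nat) (i : 'I_n) : nat :=
  (lam i - getn lam i.+1)%N.

Definition hermite (R : idomainType) (pi : R) (n : nat)
  (L : 'rV[R]_n -> Prop) (d : 'I_n -> nat) : Prop :=
  exists M : 'M[R]_n,
    [/\ (forall i j : 'I_n, (j < i)%N -> M i j = 0),
        (forall v, L v <-> exists c : 'rV[R]_n, v = c *m M) &
        forall i : 'I_n, hasval pi (M i i) (d i)].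

Definition HS_term (R : idomainType) (pi : R) (n : nat) (a b : 'I_n -> nat)
  (L : 'rV[R]_n -> Prop) : Prop :=
  [/\ is_lattice L,
      (exists lam, elem_type pi L lam /\ forall i, inc lam i = a i) &
      hermite pi L b].

Definition seteq (T : Type) (L1 L2 : T -> Prop) : Prop := forall v, L1 v <-> L2 v.

Definition HS_coef_is (R : idomainType) (pi : R) (n : nat) (a b : 'I_n -> nat)
  (c : nat) : Prop :=
  exists Ls : seq ('rV[R]_n -> Prop),
    [/\ size Ls = c,
        (forall L, List.In L Ls -> HS_term pi a b L),
        (forall L, HS_term pi a b L -> exists2 L', List.In L' Ls & seteq L L') &
        (forall i j, (i < c)%N -> (j < c)%N -> i <> j ->
           ~ seteq (nth (fun _ => False) Ls i) (nth (fun _ => False) Ls j))].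

(** * Tableaux.  Entries of [n] are encoded 0-based as 'I_n; a tableau is its
    sequence of columns, each a set of entries. *)

Definition entry (n : nat) (C : {set 'I_n}) (i : nat) : nat :=
  nth 0%N (sort leq [seq val x | x <- enum C]) i.

Definition is_SSYT (n : nat) (t : seq {set 'I_n}) : bool :=
  all (fun C => C != set0) t &&
  all (fun j => let C := nth set0 t j in let D := nth set0 t j.+1 in
         (#|D| <= #|C|)%N && all (fun i => (entry C i <= entry D i)%N) (iota 0 #|D|))
      (iota 0 (size t).-1).

Definition is_rSSYT (n : nat) (t : seq {set 'I_n}) : bool := is_SSYT t && uniq t.

Definition leg (n : nat) (t : seq {set 'I_n}) (i j : nat) : {set 'I_n} :=
  let C := nth set0 t j in let D := nth set0 t j.+1 in
  if [&& (j.+1 < size t)%N, (i < #|C|)%N, (i < #|D|)%N &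
         ~~ [exists x in C, val x == entry D i]]
  then [set x in C | (entry C i <= val x <= entry D i)%N]
  else set0.

Definition Phi (n : nat) (t : seq {set 'I_n}) (Y : rat) : rat :=
  \prod_(j < size t) \prod_(i < n)
     (if leg t i j != set0 then 1 - Y ^+ #|leg t i j| else 1).

(** Coefficient of x^a y^b in HLS_n(Y, (f_C)_C) where each f_C is the monomial
    c C * x^(ax C) * y^(ay C) (with (ax C, ay C) <> 0): expanding
    f/(1-f) = sum_{m >= 1} f^m.  Multiplicities are bounded by N, which is
    harmless since each m_j <= sum of exponents when the monomials are
    nonconstant. *)
Definition mult_ok (n l : nat) (t : l.-tuple {set 'I_n})
  (ax ay : {set 'I_n} -> 'I_n -> nat) (a b : 'I_n -> nat) (m : 'I_l -> nat) : bool :=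
  [forall j, (0 < m j)%N] &&
  [forall k, (a k == \sum_(j < l) m j * ax (tnth t j) k)%N] &&
  [forall k, (b k == \sum_(j < l) m j * ay (tnth t j) k)%N].

Definition HLS_subst_coef (n : nat) (Y : rat) (c : {set 'I_n} -> rat)
  (ax ay : {set 'I_n} -> 'I_n -> nat) (a b : 'I_n -> nat) : rat :=
  let N := (\sum_k a k + \sum_k b k)%N in
  \sum_(l < 2 ^ n) \sum_(t : l.-tuple {set 'I_n} | is_rSSYT t)
     Phi t Y *
     \sum_(m : {ffun 'I_l -> 'I_N.+1} | mult_ok t ax ay a b (fun j => val (m j)))
        \prod_(j < l) c (tnth t j) ^+ m j.

Definition sigma (n : nat) (C : {set 'I_n}) : int :=
  (\sum_(i < n | i \notin C) (i.+1)%:Z - ('C(n - #|C| + 1, 2))%:Z)%R.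

(** exponent of x_k in x_{#C} (0-based k) *)
Definition xexp (n : nat) (C : {set 'I_n}) (k : 'I_n) : nat := (k.+1 == #|C|)%N.
(** exponent of y_k in y_{C^*}, C^* = {n-i+1 : i in C} (0-based k) *)
Definition yexp (n : nat) (C : {set 'I_n}) (k : 'I_n) : nat := rev_ord k \in C.

(* Main.v *)
(** Both sides satisfy the same recursion on [n].  On the lattice side, split off
    the first coordinate: [L] is determined by [L' = L :&: (0 + o^(n-1))], by
    [delta_1], and by the class [u] modulo [L'] of the tail of the first row of a
    Hermite basis.  If [o^(n-1) / L'] has type [mu], the type [lambda] of [L] differs
    from [mu] by a horizontal strip.  Computing the lengths of
    [o^n / (L + pi^j o^n)] for all [j] expresses this strip through the valuations of
    the coordinates of [u] in [H = sum_i o / p^(mu_i)], so that the [u] producing a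
    given strip can be counted: with [theta_j] the number of boxes of the strip in
    column [j], there are
      [prod_(theta_j = 0) q^(mu'_j) *
       prod_(theta_(j-1) = 0, theta_j = 1) (1 - q^-(mu'_(j-1) - mu'_j))]
    of them.  On the tableau side, removing the entry [n] from all columns of a
    semistandard tableau of shape [lambda] removes a horizontal strip; the nonempty
    sets [Leg^+] attached to the entries [n] are exactly the descents of [theta], of
    size [mu'_(j-1) - mu'_j], and [sigma_n (C) - sigma_(n-1) (C :\ n)] is
    [#|C|] if [n] is not in [C] and [0] otherwise, which gives the same factor.
    Finally a reduced tableau with multiplicities is the run-length encoding of a
    semistandard tableau, and repeated columns have empty [Leg^+]. *)
Require Import Defs.
From HB Require Import structures.
From mathcomp Require Import all_boot all_order fingroup perm all_algebra.
From mathcomp Require Import zify ring.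
From Stdlib Require Import ClassicalEpsilon.
Set Implicit Arguments. Unset Strict Implicit. Unset Printing Implicit Defensive.
Import Order.TTheory GRing.Theory Num.Theory.
Local Open Scope ring_scope.

(** * Counting classes of an equivalence relation *)

Lemma functional_choice (A B : Type) (P : A -> B -> Prop) :
  (forall a, exists b, P a b) -> exists f : A -> B, forall a, P a (f a).
Proof.
move=> H; exists (fun a => proj1_sig (constructive_indefinite_description _ (H a))).
by move=> a; case: constructive_indefinite_description.
Qed.

(** Classical truth value of a proposition, so that arbitrary predicates can cut out finite subtypes
    and be fed to [ex_minnP]. *)
Definition holds (P : Prop) : bool :=
  if excluded_middle_informative P then true else false.

Lemma holdsP (P : Prop) : reflect P (holds P).
Proof. by rewrite /holds; case: excluded_middle_informative => H; constructor. Qed.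

Definition equivalence (T : Type) (E : T -> T -> Prop) : Prop :=
  [/\ forall x, E x x, forall x y, E x y -> E y x &
      forall x y z, E x y -> E y z -> E x z].

(** The representatives [f] enumerate, without repetition, the [E]-classes of [Q]. Lattices and
    submodules are [Prop]-valued predicates with no finite structure of their own, so cardinalities
    are stated through such enumerations. *)
Definition transversal (T I : Type) (E : T -> T -> Prop) (Q : T -> Prop)
    (f : I -> T) : Prop :=
  [/\ forall i, Q (f i), forall v, Q v -> exists i, E v (f i) &
      forall i j, E (f i) (f j) -> i = j].

Definition class_count (T : Type) (E : T -> T -> Prop) (Q : T -> Prop) (k : nat) :=
  exists f : 'I_k -> T, transversal E Q f.

Section ClassCount.
Variables (T : Type) (E : T -> T -> Prop).
Implicit Type Q : T -> Prop.

Lemma class_count_fin Q (I : finType) (f : I -> T) :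
  transversal E Q f -> class_count E Q #|I|.
Proof.
case=> fQ fE fI; exists (fun i => f (enum_val i)); split=> // [v /fE[i Ei]|i j /fI].
  by exists (enum_rank i); rewrite enum_rankK.
exact: enum_val_inj.
Qed.

Lemma class_count_ext Q Q' k :
  (forall v, Q v <-> Q' v) -> class_count E Q k -> class_count E Q' k.
Proof.
by move=> QQ [f [fQ fE fI]]; exists f; split=> // [i|v /QQ/fE //]; apply/QQ.
Qed.

Lemma class_count0 Q : (forall v, ~ Q v) -> class_count E Q 0.
Proof.
move=> nQ; exists (fun i : 'I_0 => match i with Ordinal _ h => False_rect _ (notF h) end).
by split=> [[]|v /nQ|[]].
Qed.

Hypothesis Eeq : equivalence E.

(** Sending each representative of one transversal to an equivalent representative of the other is
    injective. *)
Lemma class_count_le Q k k' :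
  class_count E Q k -> class_count E Q k' -> (k <= k')%N.
Proof.
case: Eeq => _ Es Et [f [fQ _ fI]] [g [_ gE _]].
have [h hE] := functional_choice (fun i => gE _ (fQ i)).
have: injective h.
  by move=> i j hij; apply/fI/(Et _ _ _ (hE i)); rewrite hij; apply: Es.
by move/leq_card; rewrite !card_ord.
Qed.

Lemma class_count_uniq Q k k' :
  class_count E Q k -> class_count E Q k' -> k = k'.
Proof. by move=> Hk Hk'; apply/eqP; rewrite eqn_leq !(class_count_le (Q := Q)). Qed.

Lemma class_count_sum (I : finType) (Qi : I -> T -> Prop) Q (k : I -> nat) :
  (forall v, Q v <-> exists i, Qi i v) ->
  (forall i j v w, Qi i v -> Qi j w -> E v w -> i = j) ->
  (forall i, class_count E (Qi i) (k i)) ->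
  class_count E Q (\sum_i k i)%N.
Proof.
move=> QE Qdisj cnt.
have [f fP] : exists f : forall i, 'I_(k i) -> T, forall i, transversal E (Qi i) (f i).
  exists (fun i => proj1_sig (constructive_indefinite_description _ (cnt i))).
  by move=> i; case: constructive_indefinite_description.
have -> : (\sum_i k i)%N = #|{: {i : I & 'I_(k i)}}|.
  rewrite card_tagged sumnE big_map big_enum /=.
  by apply: eq_bigr => i _; rewrite card_ord.
apply: (class_count_fin (f := fun x => f (tag x) (tagged x))).
split=> [[i x]|v /QE[i Qv]|[i x] [j y]] /=.
- by apply/QE; exists i; case: (fP i).
- by case: (fP i) => _ /(_ v Qv)[x Ex] _; exists (Tagged (fun i => (ordinal (k i))) x).
- move=> Exy; case: (fP i) => fQ _ fI; case: (fP j) => gQ _ _.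
  have ij := Qdisj _ _ _ _ (fQ x) (gQ y) Exy; subst j.
  by rewrite (fI _ _ Exy).
Qed.

Lemma class_count_filter Q (P : T -> Prop) k :
  (forall v w, E v w -> P v -> P w) ->
  class_count E Q k -> exists k', class_count E (fun v => Q v /\ P v) k'.
Proof.
move=> Pinv [f [fQ fE fI]].
exists #|{: {i : 'I_k | holds (P (f i))}}|.
apply: (class_count_fin (f := fun i => f (val i))).
split=> [[i Pi]|v [Qv Pv]|i j /fI /val_inj //] /=.
  by split=> //; apply/holdsP.
have [i Ei] := fE v Qv.
have Pi : holds (P (f i)) by apply/holdsP; exact: Pinv Ei Pv.
by exists (exist _ i Pi).
Qed.

(** The complement has some count by [class_count_filter]; additivity and uniqueness of counts force
    it to be the difference. *)
Lemma class_count_diff Q Q1 k k1 :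
  (forall v w, E v w -> Q1 v -> Q1 w) -> (forall v, Q1 v -> Q v) ->
  class_count E Q k -> class_count E Q1 k1 ->
  (k1 <= k)%N /\ class_count E (fun v => Q v /\ ~ Q1 v) (k - k1).
Proof.
case: Eeq => _ Es Et Q1inv Q1Q cQ cQ1.
have Ninv v w : E v w -> ~ Q1 v -> ~ Q1 w by move=> /Es Evw nQ /(Q1inv _ _ Evw).
have [k2 c2] := class_count_filter Ninv cQ.
suff kE : class_count E Q (k1 + k2).
  rewrite (class_count_uniq cQ kE); split; first exact: leq_addr.
  by rewrite addKn.
have -> : (k1 + k2)%N = (\sum_(b : bool) (if b then k1 else k2))%N by rewrite big_bool.
apply: (class_count_sum (Qi := fun b v => if b then Q1 v else Q v /\ ~ Q1 v)).
- move=> v; split=> [Qv|[[|]]]; [|exact: Q1Q|by case].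
  by have [Q1v|nQ1v] := classic (Q1 v); [exists true|exists false].
- case=> [] [] //= v w; first by move=> Q1v [_ nQ1w] /Q1inv /(_ Q1v).
  by move=> [_ nQ1v] Q1w /Es/Q1inv /(_ Q1w).
- by case.
Qed.

End ClassCount.

Section ClassCountMap.
Variables (T T' : Type) (E : T -> T -> Prop) (E' : T' -> T' -> Prop).
Variables (Q : T -> Prop) (Q' : T' -> Prop) (phi : T -> T').
Hypothesis E'eq : equivalence E'.
Hypothesis phiE : forall x y, Q x -> Q y -> (E x y <-> E' (phi x) (phi y)).
Hypothesis phiQ : forall x, Q x -> Q' (phi x).
Hypothesis phi_onto : forall y, Q' y -> exists2 x, Q x & E' y (phi x).

(** The section hypotheses make [phi] a bijection on classes. Here representatives are mapped
    forward; [class_count_pull] chooses preimages of them. *)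
Lemma class_count_push k : class_count E Q k -> class_count E' Q' k.
Proof.
case: E'eq => _ Es Et [f [fQ fE fI]]; exists (phi \o f); split=> [i|v Qv|i j] /=.
- exact: phiQ.
- have [x Qx Ex] := phi_onto Qv; have [i Ei] := fE x Qx.
  by exists i; apply: (Et _ _ _ Ex); apply: (proj1 (phiE Qx (fQ i)) Ei).
- by move=> /(proj2 (phiE (fQ i) (fQ j))) /fI.
Qed.

Lemma class_count_pull k : class_count E' Q' k -> class_count E Q k.
Proof.
case: E'eq => _ Es Et [f [fQ fE fI]].
have [g gP] : exists g : 'I_k -> T, forall i, Q (g i) /\ E' (f i) (phi (g i)).
  apply: (functional_choice (P := fun i x => Q x /\ E' (f i) (phi x))) => i.
  by have [x] := phi_onto (fQ i); exists x.
exists g; split=> [i|v Qv|i j]; first by case: (gP i).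
- have [i Ei] := fE _ (phiQ Qv); exists i; case: (gP i) => Qi Ei'.
  by apply: (proj2 (phiE Qv Qi)); apply: (Et _ _ _ Ei Ei').
- case: (gP i) (gP j) => Qi Ei [Qj Ej] /(proj1 (phiE Qi Qj)) Eij.
  by apply: fI; apply: (Et _ _ _ Ei); apply: (Et _ _ _ Eij); apply: Es.
Qed.
End ClassCountMap.

Lemma class_count_fiber (T T' : Type) (E : T -> T -> Prop) (E' : T' -> T' -> Prop)
    (Q : T -> Prop) (Q' : T' -> Prop) (p : T -> T') (k k' : nat) :
  equivalence E' ->
  (forall v, Q v -> Q' (p v)) ->
  (forall v w, E v w -> E' (p v) (p w)) ->
  (forall t, Q' t -> class_count E (fun v => Q v /\ E' (p v) t) k) ->
  class_count E' Q' k' -> class_count E Q (k' * k).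
Proof.
case=> _ Es Et pQ pE cnt [f [fQ fE fI]].
have -> : (k' * k = \sum_(i < k') k)%N by rewrite sum_nat_const card_ord.
apply: (class_count_sum (Qi := fun i v => Q v /\ E' (p v) (f i))).
- by move=> v; split=> [Qv|[i []//]]; have [i Ei] := fE _ (pQ _ Qv); exists i.
- move=> i j v w [_ Ei] [_ Ej] /pE Evw; apply: fI.
  by apply: (Et _ _ _ (Es _ _ Ei)); apply: (Et _ _ _ Evw Ej).
- by move=> i; apply: cnt.
Qed.

Lemma class_count_prod (T : Type) (n : nat) (E : 'I_n -> T -> T -> Prop)
    (Q : 'I_n -> T -> Prop) (k : 'I_n -> nat) :
  (forall i, class_count (E i) (Q i) (k i)) ->
  class_count (fun u v : 'rV[T]_n => forall i, E i (u 0 i) (v 0 i))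
    (fun u => forall i, Q i (u 0 i)) (\prod_i k i)%N.
Proof.
move=> cnt.
have [f fP] : exists f : forall i, 'I_(k i) -> T, forall i, transversal (E i) (Q i) (f i).
  exists (fun i => proj1_sig (constructive_indefinite_description _ (cnt i))).
  by move=> i; case: constructive_indefinite_description.
have -> : (\prod_i k i)%N = #|{dffun forall i, 'I_(k i)}|.
  rewrite card_dep_ffun foldrE big_map big_enum /=.
  by apply: eq_bigr => i _; rewrite card_ord.
apply: (class_count_fin (f := fun F : {dffun forall i, 'I_(k i)} => \row_i f i (F i))).
split=> [F i|v Qv|F G EFG].
- by rewrite mxE; case: (fP i).
- have /fin_all_exists[F FP] : forall i, exists x : 'I_(k i), E i (v 0 i) (f i x).
    by move=> i; case: (fP i) => _ /(_ _ (Qv i)).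
  by exists [ffun i => F i] => i; rewrite mxE ffunE.
- apply/ffunP => i; case: (fP i) => _ _; apply.
  by have := EFG i; rewrite !mxE.
Qed.

(** * Tableaux as chains of horizontal strips *)

Definition descent (th : nat -> bool) (j : nat) : bool := [&& (0 < j)%N, ~~ th j.-1 & th j].

(** For [Y = q^-1] and [c] the conjugate of [mu], this is the number of tails [u] modulo the lattice
    that produce the strip [th]. Columns are numbered from 0. *)
Definition strip_wt (l : nat) (Y : rat) (c : nat -> nat) (th : nat -> bool) : rat :=
  (\prod_(j < l | ~~ th j) Y^-1 ^+ c j) *
  \prod_(j < l | descent th j) (1 - Y ^+ (c j.-1 - c j)).

(** With columns numbered from 0, the value at [j] is part [j + 1] of the conjugate partition; the
    formula makes sense for unordered [lam] as well. *)
Definition conj_type n (lam : 'I_n -> nat) (j : nat) : nat := (\sum_i (j < lam i))%N.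

Definition lowc n (k : nat) (C : {set 'I_n}) : nat := (\sum_(x in C) (x < k))%N.

(** The factor of [Phi] contributed by two adjacent columns [C], [D]; it
    vanishes when they violate semistandardness. *)
Definition adj_wt n (Y : rat) (C D : {set 'I_n}) : rat :=
  \prod_(k < n | (k \in D) && (k \notin C)) (1 - Y ^+ (lowc k C - lowc k D)).

Definition opred l (j : 'I_l) : 'I_l := Ordinal (leq_ltn_trans (leq_pred j) (ltn_ord j)).

(** The columns are only constrained by their lengths and the content, since [adj_wt] kills the
    sequences that are not semistandard. At [Y = q^-1] the column weight is [q^sigma]; [rev_ord]
    accounts for the passage to [C^*]. *)
Definition tab_sum n l (Y : rat) (c : nat -> nat) (b : 'I_n -> nat) : rat :=
  \sum_(T : {ffun 'I_l -> {set 'I_n}} |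
      [forall j, #|T j| == c j] && [forall k, b k == \sum_j (rev_ord k \in T j)]%N)
    (\prod_(j < l | (0 < j)%N) adj_wt Y (T (opred j)) (T j)) *
    \prod_j Y^-1 ^ sigma (T j).

(** Because of the reversal in [C^*], the first component of [b] counts the largest entry; dropping
    it matches the removal of that entry. *)
Definition tail_fun n (b : 'I_n.+1 -> nat) (i : 'I_n) : nat := b (lift ord0 i).

Definition fun_of_ord l (th : 'I_l -> bool) (j : nat) : bool :=
  if insub j is Some i then th i else false.

Lemma fun_of_ordE l (th : 'I_l -> bool) (j : 'I_l) : fun_of_ord th j = th j.
Proof. by rewrite /fun_of_ord valK. Qed.

Definition add_max n (C : {set 'I_n}) (t : bool) : {set 'I_n.+1} :=
  [set x | if unlift ord_max x is Some y then y \in C else t].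

Lemma in_add_max n (C : {set 'I_n}) t y : (lift ord_max y \in add_max C t) = (y \in C).
Proof. by rewrite inE liftK. Qed.

Lemma max_add_max n (C : {set 'I_n}) t : (ord_max \in add_max C t) = t.
Proof. by rewrite inE unlift_none. Qed.

Lemma widen_lift n (y : 'I_n) : widen_ord (leqnSn n) y = lift ord_max y.
Proof. by apply/val_inj; exact: esym (lift_max y). Qed.

Lemma sum_add_max n (C : {set 'I_n}) t (F : nat -> nat) :
  (\sum_(x in add_max C t) F x = \sum_(x in C) F x + (if t then F n else 0))%N.
Proof.
rewrite big_mkcond big_ord_recr /= max_add_max; congr (_ + _)%N.
rewrite [RHS]big_mkcond; apply: eq_bigr => x _.
by rewrite widen_lift in_add_max.
Qed.

Lemma card_add_max n (C : {set 'I_n}) t : #|add_max C t| = (#|C| + t)%N.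
Proof. by rewrite -!sum1_card (sum_add_max C t (fun=> 1%N)); case: t. Qed.

Lemma lowc_max n (C : {set 'I_n}) : lowc n C = #|C|.
Proof. by rewrite /lowc -sum1_card; apply: eq_bigr => x _; rewrite ltn_ord. Qed.

Lemma lowc_add_max n (C : {set 'I_n}) t k : (k <= n)%N -> lowc k (add_max C t) = lowc k C.
Proof.
move=> kn; rewrite /lowc (sum_add_max C t (fun x => nat_of_bool (x < k)%N)) ltnNge kn /=.
by case: t; rewrite addn0.
Qed.

(** The only new index is [n], and below [n] the counting function [lowc] is the full
    cardinality. *)
Lemma adj_wt_add_max n Y (C D : {set 'I_n}) s t :
  adj_wt Y (add_max C s) (add_max D t) =
  adj_wt Y C D * (if t && ~~ s then 1 - Y ^+ (#|C| - #|D|) else 1).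
Proof.
rewrite /adj_wt big_mkcond big_ord_recr /= !max_add_max !lowc_add_max // !lowc_max.
congr (_ * _); rewrite [RHS]big_mkcond; apply: eq_bigr => k _.
by rewrite widen_lift !in_add_max !lowc_add_max // ltnW.
Qed.

(** If the new maximum is absent, the sum gains [n + 1] while the binomial coefficient grows by
    [n - #|C| + 1]; if it is present, neither changes. *)
Lemma sigma_add_max n (C : {set 'I_n}) t :
  sigma (add_max C t) = sigma C + (if t then 0 else #|C|%:Z).
Proof.
have Cn : (#|C| <= n)%N by rewrite -[X in (_ <= X)%N]card_ord max_card.
rewrite /sigma big_mkcond big_ord_recr /= max_add_max card_add_max.
have -> : \sum_(i < n) (if widen_ord (leqnSn n) i \notin add_max C t then (i.+1)%:Z else 0) =
    \sum_(i < n | i \notin C) (i.+1)%:Z.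
  by rewrite [RHS]big_mkcond; apply: eq_bigr => i _; rewrite widen_lift in_add_max.
case: t => /=.
  by rewrite (_ : n.+1 - (#|C| + 1) + 1 = n - #|C| + 1)%N ?addr0 //; lia.
rewrite (_ : n.+1 - (#|C| + 0) + 1 = (n - #|C| + 1).+1)%N; last by lia.
by rewrite binS bin1 !PoszD -subzn // -[n.+1]addn1 PoszD; ring.
Qed.

Lemma add_max_bij n l :
  bijective (fun p : {ffun 'I_l -> bool} * {ffun 'I_l -> {set 'I_n}} =>
    [ffun j => add_max (p.2 j) (p.1 j)]).
Proof.
exists (fun T : {ffun 'I_l -> {set 'I_n.+1}} =>
  ([ffun j => ord_max \in T j], [ffun j => [set y | lift ord_max y \in T j]])).
  case=> th T; congr pair; apply/ffunP => j; rewrite !ffunE ?max_add_max //.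
  by apply/setP => y; rewrite inE in_add_max.
move=> T; apply/ffunP => j; rewrite !ffunE; apply/setP => x; rewrite inE.
by case: unliftP => [y ->|->]; rewrite ?inE.
Qed.

(** Each column splits bijectively into a bit for the largest entry and the rest of the column; the
    weights factor by [adj_wt_add_max] and [sigma_add_max]. *)
Lemma tab_sumS n l Y c (b : 'I_n.+1 -> nat) : Y != 0 :> rat ->
  tab_sum l Y c b =
  \sum_(th : {ffun 'I_l -> bool} |
      (b ord0 == \sum_j th j)%N && [forall j : 'I_l, th j <= c j]%N)
    strip_wt l Y (fun j => c j - fun_of_ord th j)%N (fun_of_ord th) *
    tab_sum l Y (fun j => c j - fun_of_ord th j)%N (tail_fun b).
Proof.
move=> Y0; rewrite /tab_sum (reindex _ (onW_bij _ (add_max_bij n l))) /=.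
under [RHS]eq_bigr do rewrite big_distrr /=.
rewrite pair_big_dep /=; apply: eq_big => [[th T]|[th T]] /=.
  have -> : [forall j, #|[ffun j => add_max (T j) (th j)] j| == c j] =
      [forall j : 'I_l, th j <= c j]%N &&
      [forall j : 'I_l, #|T j| == (c j - fun_of_ord th j)%N].
    apply/forallP/andP => [H|[/forallP H1 /forallP H2] j].
      by split; apply/forallP => j; have := H j; rewrite ffunE card_add_max ?fun_of_ordE; lia.
    by have := H1 j; have := H2 j; rewrite ffunE card_add_max fun_of_ordE; lia.
  have revS k : rev_ord (lift ord0 k) = lift ord_max (rev_ord k : 'I_n).
    by apply/val_inj; rewrite /= /bump /= leqNgt; have := ltn_ord k; lia.
  have -> : [forall k, b k == \sum_j (rev_ord k \in [ffun j0 => add_max (T j0) (th j0)] j)]%N =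
      (b ord0 == \sum_j th j)%N && [forall k, tail_fun b k == \sum_j (rev_ord k \in T j)]%N.
    have E0 : (\sum_j (rev_ord ord0 \in [ffun j0 => add_max (T j0) (th j0)] j) = \sum_j th j)%N.
      apply: eq_bigr => j _; rewrite ffunE (_ : rev_ord _ = ord_max) ?max_add_max //.
      by apply/val_inj; rewrite /= subn1.
    have ES k : (\sum_j (rev_ord (lift ord0 k) \in [ffun j0 => add_max (T j0) (th j0)] j) =
        \sum_j (rev_ord k \in T j))%N.
      by apply: eq_bigr => j _; rewrite ffunE revS in_add_max.
    apply/forallP/andP => [H|[H0 /forallP H] k].
      split; first by rewrite -E0.
      by apply/forallP => k; rewrite -ES; apply: H.
    by case: (unliftP ord0 k) => [k' ->|->]; rewrite ?ES ?E0 //; apply: H.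
  by rewrite -!andbA; do !bool_congr.
case/andP=> /forallP cT _.
have cE (j : 'I_l) : (c j - fun_of_ord th j)%N = #|T j|.
  by have := cT j; rewrite ffunE card_add_max fun_of_ordE => /eqP <-; rewrite addnK.
have -> : strip_wt l Y (fun j => c j - fun_of_ord th j)%N (fun_of_ord th) =
   (\prod_(j < l | ~~ th j) Y^-1 ^+ #|T j|) *
   \prod_(j < l | (0 < j)%N) (if th j && ~~ th (opred j)
     then 1 - Y ^+ (#|T (opred j)| - #|T j|) else 1).
  rewrite /strip_wt; congr (_ * _).
    by apply: eq_big => j; rewrite ?cE ?fun_of_ordE.
  rewrite -big_mkcondr /=; apply: eq_big => j.
    by rewrite /descent (fun_of_ordE th (opred j)) fun_of_ordE; case: (th _); case: (th _).
  by move=> _; rewrite (cE (opred j)) cE.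
have -> : \prod_(j < l | (0 < j)%N) adj_wt Y
      ([ffun j0 => add_max (T j0) (th j0)] (opred j)) ([ffun j0 => add_max (T j0) (th j0)] j) =
    (\prod_(j < l | (0 < j)%N) adj_wt Y (T (opred j)) (T j)) *
    \prod_(j < l | (0 < j)%N) (if th j && ~~ th (opred j)
      then 1 - Y ^+ (#|T (opred j)| - #|T j|) else 1).
  by rewrite -big_split; apply: eq_bigr => j _; rewrite !ffunE adj_wt_add_max.
have -> : \prod_j Y^-1 ^ sigma ([ffun j0 => add_max (T j0) (th j0)] j) =
    (\prod_j Y^-1 ^ sigma (T j)) * \prod_(j < l | ~~ th j) Y^-1 ^+ #|T j|.
  rewrite [X in _ * X]big_mkcond -big_split; apply: eq_bigr => j _ /=.
  rewrite ffunE sigma_add_max exprzDr ?unitfE ?invr_eq0 //.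
  by case: (th j).
ring.
Qed.

Lemma tab_sum0 l Y c (b : 'I_0 -> nat) :
  tab_sum l Y c b = if [forall j : 'I_l, c j == 0%N] then 1 else 0.
Proof.
have T0 (C : {set 'I_0}) : C = set0 by apply/setP => -[].
rewrite /tab_sum (eq_bigl (fun T => [forall j : 'I_l, c j == 0%N] && (T == [ffun=> set0]))).
  case: ifP => _; last by rewrite big_pred0.
  rewrite big_pred1_eq !big1 ?mulr1 // => j _; last by rewrite /adj_wt big_ord0.
  by rewrite /sigma big_ord0 ffunE cards0.
move=> T; have -> : T = [ffun=> set0] by apply/ffunP => j; rewrite ffunE; apply: T0.
rewrite eqxx andbT [X in _ && X](_ : _ = true) ?andbT; last by apply/forallP => -[].
by apply: eq_forallb => j; rewrite ffunE cards0 eq_sym.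
Qed.

(** * Columns of semistandard tableaux *)

(** Semistandardness of two adjacent columns in cumulative form. In this form it is easily seen to
    be a partial order, and it is the condition under which [adj_wt] has no forced zero. *)
Definition col_le n (C D : {set 'I_n}) : bool := [forall k : 'I_n.+1, lowc k D <= lowc k C]%N.

Lemma col_leP n (C D : {set 'I_n}) :
  reflect (forall k, lowc k D <= lowc k C)%N (col_le C D).
Proof.
apply: (iffP forallP) => [H k|H k]; last exact: H.
have [kn|nk] := leqP k n; first by have := H (inord k); rewrite inordK.
have big E : lowc k E = #|E :> {set 'I_n}|.
  rewrite -lowc_max; apply: eq_bigr => x _.
  by rewrite ltn_ord (leq_trans (ltn_ord x) (ltnW nk)).
by rewrite !big -!lowc_max; have := H ord_max.
Qed.

Lemma col_le_refl n : reflexive (@col_le n).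
Proof. by move=> C; apply/col_leP. Qed.

Lemma col_le_trans n : transitive (@col_le n).
Proof.
move=> D C E /col_leP H1 /col_leP H2; apply/col_leP => k.
exact: leq_trans (H2 k) (H1 k).
Qed.

Lemma lowcS n k (C : {set 'I_n}) : lowc k.+1 C = (lowc k C + [exists x in C, val x == k])%N.
Proof.
rewrite /lowc; case: existsP => [[x /andP[xC /eqP xk]]|nx].
  rewrite !(bigD1 x xC) /= xk ltnSn ltnn add0n addnC; congr (_ + _)%N.
  apply: eq_bigr => y /andP[_ yx]; congr nat_of_bool; rewrite ltnS leq_eqVlt.
  by move: yx; rewrite -val_eqE /= xk => /negPf->.
rewrite addn0; apply: eq_bigr => y yC; congr nat_of_bool; rewrite ltnS leq_eqVlt.
by case: eqP => //= yk; case: nx; exists y; rewrite yC; apply/eqP.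
Qed.

Lemma in_lowc n (x : 'I_n) (C : {set 'I_n}) : (x \in C) = [exists y in C, val y == x].
Proof.
apply/idP/existsP => [xC|[y /andP[yC /eqP/val_inj <-]]] //.
by exists x; rewrite xC eqxx.
Qed.

Lemma col_le_anti n : antisymmetric (@col_le n).
Proof.
move=> C D /andP[/col_leP H1 /col_leP H2]; apply/setP => x; rewrite !in_lowc.
have E k : lowc k C = lowc k D by apply/eqP; rewrite eqn_leq H1 H2.
by have := lowcS x C; rewrite !E lowcS => /addnI; do 2!case: [exists _ in _, _].
Qed.

Lemma adj_wt_refl n Y (C : {set 'I_n}) : adj_wt Y C C = 1.
Proof. by rewrite /adj_wt big_pred0 // => k; rewrite andbN. Qed.

(** At the first place [x] where the cumulative condition fails, [x] lies in [D] but not in [C] and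
    both columns have equally many entries below [x], so the factor at [x] is [1 - Y ^+ 0]. *)
Lemma adj_wt0 n Y (C D : {set 'I_n}) : ~~ col_le C D -> adj_wt Y C D = 0.
Proof.
move=> nle.
have exk : exists k, (lowc k C < lowc k D)%N.
  have [k nk] := forallPn nle; by exists k; rewrite ltnNge.
case: (ex_minnP exk) => -[|k]; first by rewrite /lowc !big1.
move=> lt kmin; have le : (lowc k D <= lowc k C)%N.
  by rewrite leqNgt; apply/negP => /kmin; rewrite ltnn.
move: lt; rewrite !lowcS.
case: (boolP [exists x in D, _]) => [/existsP[x /andP[xD /eqP xk]]|_]; last by move=> H;
  exfalso; lia.
case: (boolP [exists x in C, _]) => [_|nC]; first by move=> H; exfalso; lia.
rewrite addn0 addn1 ltnS => lt; rewrite /adj_wt (bigD1 x) /=.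
  have -> : lowc x C = lowc x D by apply/eqP; rewrite xk eqn_leq lt le.
  by rewrite subnn expr0 subrr mul0r.
rewrite xD; apply: contra nC => xC.
by apply/existsP; exists x; rewrite xC xk eqxx.
Qed.

Lemma entry_enum n (C : {set 'I_n}) i : entry C i = nth 0%N [seq val x | x <- enum C] i.
Proof.
rewrite /entry sorted_sort //; first exact: leq_trans.
have: subseq [seq val x | x <- enum C] (iota 0 n).
  by rewrite -val_enum_ord; apply: map_subseq; rewrite enumT; apply: filter_subseq.
move/subseq_sorted; apply; first exact: leq_trans.
exact: iota_sorted.
Qed.

(** Columns increase, so the entries below [k] are exactly the first [lowc k C] of them. *)
Lemma entry_ltn n (C : {set 'I_n}) i k : (i < #|C|)%N -> (entry C i < k)%N = (i < lowc k C)%N.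
Proof.
move=> iC; rewrite entry_enum.
set s := [seq val x | x <- enum C].
have ss : sorted ltn s.
  have: subseq s (iota 0 n) by rewrite -val_enum_ord; apply: map_subseq; rewrite enumT;
    apply: filter_subseq.
  by move/subseq_sorted; apply; [exact: ltn_trans|exact: iota_ltn_sorted].
have -> : lowc k C = count (fun x => x < k)%N s.
  by rewrite count_map -sum1_count big_mkcond /lowc -big_enum; apply: eq_bigr => x _ /=;
    case: ltnP.
have : (i < size s)%N by rewrite size_map -cardE.
elim: s i ss {iC} => //= x s IHs [|i] /= ss.
  move=> _; case: ltnP => // kx; rewrite add0n lt0n; apply/esym/negbTE; rewrite negbK.
  rewrite -leqn0 leqNgt -has_count -all_predC; apply/allP => y ys /=.
  by have := order_path_min ltn_trans ss => /allP/(_ y ys); lia.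
rewrite ltnS => is'; rewrite IHs ?(path_sorted ss) //.
case: (ltnP x k) => [|kx]; first by rewrite add1n.
suff -> : count (fun x0 => x0 < k)%N s = 0%N by [].
apply/eqP; rewrite -leqn0 leqNgt -has_count -all_predC; apply/allP => y ys /=.
by have := order_path_min ltn_trans ss => /allP/(_ y ys); lia.
Qed.

Lemma col_leE n (C D : {set 'I_n}) :
  (#|D| <= #|C|)%N && all (fun i => (entry C i <= entry D i)%N) (iota 0 #|D|) = col_le C D.
Proof.
apply/andP/col_leP => [[DC /allP H] k|H].
  rewrite leqNgt; apply/negP => lt.
  have lD : (lowc k C < #|D|)%N.
    by apply: leq_trans lt _; rewrite -sum1_card leq_sum // => x _; case: ltnP.
  have := entry_ltn k lD; rewrite lt => eD.
  have := entry_ltn k (leq_trans lD DC); rewrite ltnn.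
  by have := H (lowc k C); rewrite mem_iota add0n lD => /(_ isT); lia.
have DC : (#|D| <= #|C|)%N by have := H n; rewrite !lowc_max.
split=> //; apply/allP => i; rewrite mem_iota add0n => /= iD.
rewrite -ltnS entry_ltn ?(leq_trans iD DC) //.
by apply: leq_trans (H _); rewrite -entry_ltn.
Qed.

Lemma entry_ord n (D : {set 'I_n}) i : (i < #|D|)%N -> exists2 x, x \in D & entry D i = val x.
Proof.
move=> iD; have x0 : 'I_n by case: (enum D) (cardE D) iD => [->|x].
exists (nth x0 (enum D) i); first by rewrite -mem_enum mem_nth // -cardE.
by rewrite entry_enum (nth_map x0) // -cardE.
Qed.

Lemma lowc_entry n (D : {set 'I_n}) i : (i < #|D|)%N -> lowc (entry D i) D = i.
Proof.
move=> iD; have lt := entry_ltn (entry D i).+1 iD; rewrite ltnSn lowcS in lt.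
have := entry_ltn (entry D i) iD; rewrite ltnn.
by case: [exists _ in D, _] lt => /=; lia.
Qed.

Lemma is_SSYT_sorted n (t : seq {set 'I_n}) :
  is_SSYT t = all (fun C => C != set0) t && sorted (@col_le n) t.
Proof.
rewrite /is_SSYT; congr (_ && _); apply/allP/(sortedP set0) => H j.
  move=> jt; rewrite -col_leE; apply: H.
  by rewrite mem_iota add0n; case: (size t) jt.
rewrite mem_iota add0n => /= jt; rewrite col_leE; apply: H.
by case: (size t) jt.
Qed.

Lemma leg_set0 n (t : seq {set 'I_n}) i j :
  ~~ ((i < #|nth set0 t j.+1|) && (j.+1 < size t))%N -> leg t i j = set0.
Proof. by rewrite /leg => H; case: ifP => // /and4P[jt _ iD _]; rewrite jt iD in H. Qed.

(** The leg consists of the entries of [C] from its row [i] up to [x]. There are [lowc x C - i] of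
    them, and [i = lowc x D]; the entry of [C] in row [i] shows that the leg is nonempty. *)
Lemma leg_wt n Y (t : seq {set 'I_n}) i j (x : 'I_n)
    (C := nth set0 t j) (D := nth set0 t j.+1) :
  (j.+1 < size t)%N -> col_le C D -> (i < #|D|)%N -> entry D i = x ->
  (if leg t i j != set0 then 1 - Y ^+ #|leg t i j| else 1 : rat) =
  (if x \notin C then 1 - Y ^+ (lowc x C - lowc x D) else 1).
Proof.
move=> jt CD iD xE.
have iC : (i < #|C|)%N.
  by apply: leq_trans iD _; move: CD; rewrite -col_leE => /andP[].
have lt : (entry C i <= entry D i)%N.
  by move: CD; rewrite -col_leE => /andP[_ /allP->] //; rewrite mem_iota add0n.
rewrite /leg -/C -/D jt iC iD /= xE -in_lowc.
have [xC|nxC] /= := boolP (x \in C); first by rewrite eqxx.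
set S := [set _ in C | _].
have [y yC yE] := entry_ord iC.
have -> : S != set0.
  by apply/set0Pn; exists y; rewrite !inE yC -xE -yE leqnn lt.
congr (1 - _ ^+ _).
have -> : lowc x D = i by rewrite -xE lowc_entry.
rewrite -[in RHS](lowc_entry iC) /lowc -sumnB; last first.
  by move=> z _; rewrite -xE; case: (ltnP z (entry C i)); lia.
rewrite -sum1_card big_mkcond /= [RHS]big_mkcond /=; apply: eq_bigr => z _.
rewrite !inE; case: (boolP (z \in C)) => //= zC.
have : val z != x by apply: contraNneq nxC => /val_inj <-.
rewrite /= => zx; rewrite xE in lt.
by case: (ltnP z (entry C i)); case: (leqP z x); case: (ltnP z x) => //=; lia.
Qed.

(** The rows of [D] are reindexed by the entries they hold; rows beyond [D] have empty legs. *)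
Lemma prod_leg_adj_wt n Y (t : seq {set 'I_n}) j :
  (j.+1 < size t)%N -> col_le (nth set0 t j) (nth set0 t j.+1) ->
  \prod_(i < n) (if leg t i j != set0 then 1 - Y ^+ #|leg t i j| else 1) =
  adj_wt Y (nth set0 t j) (nth set0 t j.+1).
Proof.
set C := nth set0 t j; set D := nth set0 t j.+1 => jt CD.
have Dn : (#|D| <= n)%N by rewrite -[X in (_ <= X)%N]card_ord max_card.
rewrite /adj_wt big_mkcondr /= [RHS]big_enum_val /=.
rewrite (bigID (fun i : 'I_n => (i < #|D|)%N)) /= [X in _ * X = _]big1 ?mulr1; last first.
  by move=> i iD; rewrite leg_set0 ?eqxx // jt andbT.
rewrite (big_ord_narrow Dn) /=; apply: eq_bigr => i _.
apply: leg_wt => //.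
by rewrite entry_enum (nth_map (enum_val i)) -?cardE // -enum_val_nth.
Qed.

Definition chain_wt n Y (s : seq {set 'I_n}) : rat :=
  \prod_(j < (size s).-1) adj_wt Y (nth set0 s j) (nth set0 s j.+1).

Lemma Phi_chain_wt n Y (t : seq {set 'I_n}) :
  sorted (@col_le n) t -> Phi t Y = chain_wt Y t.
Proof.
move=> /(sortedP set0) st; rewrite /Phi /chain_wt.
have leg_last j : (j.+1 < size t)%N = false ->
    \prod_(i < n) (if leg t i j != set0 then 1 - Y ^+ #|leg t i j| else 1) = 1.
  by move=> jt; rewrite big1 // => i _; rewrite leg_set0 ?eqxx // jt andbF.
case E: (size t) => [|k] /=; first by rewrite !big_ord0.
rewrite big_ord_recr /= leg_last ?E ?ltnn // mulr1.
apply: eq_bigr => j _; apply: prod_leg_adj_wt; first by rewrite E ltnS.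
by apply: st; rewrite E ltnS.
Qed.

Lemma chain_wt_cons2 n Y (C D : {set 'I_n}) s :
  chain_wt Y (C :: D :: s) = adj_wt Y C D * chain_wt Y (D :: s).
Proof. by rewrite /chain_wt /= big_ord_recl. Qed.

(** By antisymmetry equal columns of a sorted chain are adjacent, and a repeated column contributes
    the factor 1. *)
Lemma chain_wt_undup n Y (s : seq {set 'I_n}) :
  sorted (@col_le n) s -> chain_wt Y (undup s) = chain_wt Y s.
Proof.
have [m le_m] := ubnP (size s); elim: s m {le_m} => // C [|D s] IHs _ //.
move=> ss; have /andP[CD Ds] := ss.
have {IHs} IH := IHs 0%N Ds.
(* [undup] keeps last occurrences, but the copies of [D] form an initial run, so the head stays
   [D]. *)
have hd : exists s', undup (D :: s) = D :: s'.
  elim: s D Ds {CD ss IH} => [|E s IHs] D /=; first by exists [::].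
  case/andP=> DE Es; have [s' /= E'] := IHs E Es.
  case: ifP => [|_]; last by exists (undup (E :: s)).
  rewrite inE => /orP[/eqP->|Ds]; first by exists s'.
  have DE' : D = E.
    apply: col_le_anti; rewrite DE /=.
    by have := order_path_min (@col_le_trans n) Es => /allP; apply.
  by rewrite DE'; exists s'.
have [s' E] := hd.
rewrite chain_wt_cons2 -IH.
rewrite [in LHS](_ : undup _ = if C \in D :: s then undup (D :: s) else C :: undup (D :: s)) //.
case: ifP => [Cs|_]; last by rewrite E chain_wt_cons2.
have -> : C = D.
  apply: col_le_anti; rewrite CD /=; move: Cs; rewrite inE => /orP[/eqP->|Cs];
    first exact: col_le_refl.
  by have := order_path_min (@col_le_trans n) Ds => /allP; apply.
by rewrite adj_wt_refl mul1r.
Qed.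

Lemma chain_wt0 n Y (s : seq {set 'I_n}) : ~~ sorted (@col_le n) s -> chain_wt Y s = 0.
Proof.
elim: s => // C [|D s] IHs //=; rewrite chain_wt_cons2 negb_and.
by case/orP=> [/adj_wt0->|/IHs->]; rewrite ?mul0r ?mulr0.
Qed.

Lemma chain_wt_ffun n l Y (T : {ffun 'I_l -> {set 'I_n}}) :
  \prod_(j < l | (0 < j)%N) adj_wt Y (T (opred j)) (T j) = chain_wt Y (codom T).
Proof.
rewrite /chain_wt size_codom card_ord.
have nthT (j : 'I_l) : nth set0 (codom T) j = T j.
  by rewrite codomE (nth_map j) ?size_enum_ord // nth_ord_enum.
case: l T nthT => [|l] T nthT; first by rewrite !big_ord0.
rewrite big_mkcond big_ord_recl /= mul1r; apply: eq_bigr => j _.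
rewrite -(nthT (opred _)) -(nthT (lift _ _)) /=.
by rewrite /bump.
Qed.

(** * Conjugation *)

(** For weakly decreasing [f] the rows that reach column [j] form an initial segment, so a box can
    be read off by rows or by columns. *)
Lemma conj_typeP m (f : 'I_m -> nat) (k : 'I_m) j :
  (forall i i' : 'I_m, (i <= i')%N -> (f i' <= f i)%N) ->
  (k < conj_type f j)%N = (j < f k)%N.
Proof.
move=> mono; rewrite /conj_type.
have km : (k.+1 <= m)%N := ltn_ord k.
have [jk|kj] := ltnP j (f k).
  have {1}<- : (\sum_(i < k.+1) 1 = k.+1)%N by rewrite sum1_card card_ord.
  rewrite (big_ord_widen _ (fun=> 1%N) km) big_mkcond /=; apply: leq_sum => i _.
  by case: ifP => // ik; rewrite (leq_trans jk) // mono.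
apply/negbTE; rewrite -leqNgt.
have {1}<- : (\sum_(i < k) 1 = k :> nat)%N by rewrite sum1_card card_ord.
rewrite (big_ord_widen _ (fun=> 1%N) (ltnW km)) [X in (_ <= X)%N]big_mkcond /=;
  apply: leq_sum => i _.
by case: ltnP => // ji; case: ltnP => // ki; have := mono k i ki; lia.
Qed.

(** These are the parts of the partition whose increments [inc] are [a]. *)
Definition tail_sum n (a : 'I_n -> nat) (i : nat) : nat := (\sum_(k < n | (i <= k)%N) a k)%N.

Lemma tail_sumS n (a : 'I_n -> nat) (i : 'I_n) :
  (tail_sum a i = a i + tail_sum a i.+1)%N.
Proof.
rewrite /tail_sum (bigD1 i) //=; congr (_ + _)%N; apply: eq_bigl => k.
by rewrite -val_eqE /= ltn_neqAle andbC eq_sym.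
Qed.

Lemma tail_sum_mono n (a : 'I_n -> nat) i j : (i <= j)%N -> (tail_sum a j <= tail_sum a i)%N.
Proof.
move=> ij; rewrite /tail_sum big_mkcond [X in (_ <= X)%N]big_mkcond; apply: leq_sum => k _.
by case: ifP => // jk; rewrite (leq_trans ij jk).
Qed.

(** Both conditions say that the number of columns longer than [i] is [tail_sum a i]; conjugation
    passes between this and the individual column lengths. *)
Lemma column_sizes n (a : 'I_n -> nat) (s : seq {set 'I_n}) :
  sorted (@col_le n) s -> all (fun C => C != set0) s ->
  (size s = \sum_k a k /\
     forall j, j < size s -> #|nth set0 s j| = conj_type (fun i : 'I_n => tail_sum a i) j)%N <->
  (forall k : 'I_n, a k = count (fun C : {set 'I_n} => #|C| == k.+1) s).
Proof.
move=> ss s0; pose d (j : 'I_(size s)) := #|nth set0 s j|.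
have d_mono (j j' : 'I_(size s)) : (j <= j')%N -> (d j' <= d j)%N.
  move=> jj'; have := sorted_leq_nth (@col_le_trans n) (@col_le_refl n) set0 ss.
  move/(_ j j' (ltn_ord j) (ltn_ord j') jj').
  by rewrite -col_leE => /andP[].
have cardn (C : {set 'I_n}) : (#|C| <= n)%N by rewrite -[X in (_ <= X)%N]card_ord max_card.
have sum_nth (F : {set 'I_n} ->
  nat) : (\sum_(C <- s) F C = \sum_(j < size s) F (nth set0 s j))%N.
  by rewrite (big_nth set0) big_mkord.
have cntE i : count (fun C : {set 'I_n} => (i < #|C|)%N) s = conj_type d i.
  by rewrite -sum1_count big_mkcond sum_nth; apply: eq_bigr => j _; rewrite /d; case: ltnP.
have dE (j : 'I_(size s)) i : (i < d j)%N = (j < conj_type d i)%N by rewrite conj_typeP.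
have d_sum j : d j = (\sum_(i < n) (i < d j))%N.
  have dn : (d j <= n)%N := cardn _.
  rewrite -big_mkcond /= -(big_ord_widen _ (fun=> 1%N) dn) sum1_card card_ord //.
split=> [[sz dc] k|ak].
  have dcj (j : 'I_(size s)) : d j = conj_type (fun i : 'I_n => tail_sum a i) j by apply: dc.
  have cnt_tail i : (i <= n)%N -> conj_type d i = tail_sum a i.
    rewrite leq_eqVlt => /orP[/eqP->|lt].
      rewrite /tail_sum big_pred0 => [|k']; last by rewrite leqNgt ltn_ord.
      by rewrite /conj_type big1 // => j _; rewrite ltnNge cardn.
    have tl : (tail_sum a i <= size s)%N.
      by rewrite sz; apply: leq_trans (tail_sum_mono a (leq0n i)) _.
    rewrite /conj_type -[RHS]card_ord -sum1_card (big_ord_widen _ (fun=> 1%N) tl).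
    rewrite [RHS]big_mkcond; apply: eq_bigr => j _.
    rewrite dcj (conj_typeP (Ordinal lt)) => [|i1 i2]; last exact: tail_sum_mono.
    by case: ltnP.
  have := tail_sumS a k; rewrite -!cnt_tail ?(ltnW (ltn_ord k)) //.
  have -> : conj_type d k = (count (fun C : {set 'I_n} => #|C| == k.+1) s + conj_type d k.+1)%N.
    by rewrite -!cntE; elim: (s) => //= C r ->; case: ltngtP; lia.
  by move/addIn.
have cnt_tail i : conj_type d i = tail_sum a i.
  rewrite -cntE /tail_sum; under [RHS]eq_bigr do rewrite ak -sum1_count big_mkcond /=.
  rewrite exchange_big /= -sum1_count big_mkcond; apply: eq_bigr => C _ /=.
  move: #|C| (cardn C) => c cn; case: ifP => [iC|nC].
    have C0 : (c.-1 < n)%N by lia.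
    rewrite (bigD1 (Ordinal C0)) /=; last by lia.
    rewrite big1 => [|k' /andP[_ nk]]; first by rewrite ifT //; lia.
    by rewrite ifF //; apply: contraNF nk => /eqP E; apply/eqP/val_inj; rewrite /= E.
  by rewrite big1 // => k' ik; rewrite ifF //; apply/negP => /eqP E; move: nC;
    rewrite E ltnS ik.
split=> [|j js]; last first.
  rewrite -[#|_|]/(d (Ordinal js)) d_sum; apply: eq_bigr => i _.
  by rewrite dE cnt_tail.
have -> : (\sum_k a k = tail_sum a 0)%N by [].
rewrite -cnt_tail -cntE; apply/esym/eqP; rewrite -all_count.
by apply/allP => C Cs; rewrite card_gt0; apply: (allP s0).
Qed.

(** * Run-length encoding *)

Definition expand (T : eqType) (t : seq T) (f : T -> nat) : seq T :=
  flatten [seq nseq (f C) C | C <- t].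

Section Expand.
Variables (T : eqType) (t : seq T) (f : T -> nat).

Lemma count_expand (p : pred T) : count p (expand t f) = (\sum_(C <- t) f C * p C)%N.
Proof.
rewrite count_flatten sumnE !big_map; apply: eq_bigr => C _.
by rewrite count_nseq mulnC.
Qed.

Lemma prod_expand (A : comPzRingType) (F : T -> A) :
  \prod_(C <- expand t f) F C = \prod_(C <- t) F C ^+ f C.
Proof.
rewrite big_flatten big_map; apply: eq_bigr => C _.
by rewrite big_nseq_cond /= iter_mulr_1.
Qed.

Lemma expand_sub C : C \in expand t f -> C \in t.
Proof. by case/flatten_mapP => D Dt; rewrite mem_nseq => /andP[_ /eqP->]. Qed.

Hypothesis uniq_t : uniq t.

Lemma count_mem_expand C : C \in t -> count_mem C (expand t f) = f C.
Proof.
move=> Ct; rewrite count_expand (bigD1_seq C) //= eqxx muln1 big1 ?addn0 // => D DC.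
by rewrite (negPf DC) muln0.
Qed.

End Expand.

Lemma expand_sorted n (t : seq {set 'I_n}) f :
  sorted (@col_le n) t -> sorted (@col_le n) (expand t f).
Proof.
rewrite !(sorted_pairwise (@col_le_trans n)); elim: t => //= C t IHt /andP[Ct st].
rewrite /expand /= pairwise_cat IHt // andbT; apply/andP; split.
  apply/allrelP => D E; rewrite mem_nseq => /andP[_ /eqP->] /expand_sub.
  exact: (allP Ct).
by elim: (f C) => //= k ->; rewrite andbT; apply/allP => D;
  rewrite mem_nseq => /andP[_ /eqP->]; apply: col_le_refl.
Qed.

(** A sequence sorted for the antisymmetric [col_le] is determined by its multiset. Together with
    [expand_undup] this makes run-length encoding and decoding mutually inverse. *)
Lemma undup_expand n (t : seq {set 'I_n}) f :
  sorted (@col_le n) t -> uniq t -> (forall C, C \in t -> 0 < f C)%N ->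
  undup (expand t f) = t.
Proof.
move=> st ut f0; apply: (sorted_eq (@col_le_trans n) (@col_le_anti n)) => //.
  by apply: undup_sorted (expand_sorted _ st); apply: col_le_trans.
apply: uniq_perm => // [|C]; first exact: undup_uniq.
rewrite mem_undup; apply/idP/idP => [|Ct]; first exact: expand_sub.
by apply/flatten_mapP; exists C => //; rewrite mem_nseq f0 /=.
Qed.

Lemma expand_undup n (s : seq {set 'I_n}) :
  sorted (@col_le n) s -> expand (undup s) (fun C => count_mem C s) = s.
Proof.
move=> ss; apply: (sorted_eq (@col_le_trans n) (@col_le_anti n)) => //.
  by apply: expand_sorted; apply: undup_sorted ss; apply: col_le_trans.
exact: perm_count_undup.
Qed.

Section RunLength.
Variables (n : nat) (Y : rat) (a b : 'I_n -> nat).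
Let l := (\sum_k a k)%N.
Let N := (\sum_k a k + \sum_k b k)%N.
Let shape := conj_type (fun i : 'I_n => tail_sum a i).
Let w (C : {set 'I_n}) : rat := Y^-1 ^ sigma C.

(** [a] prescribes the shape through the number of columns of each length, and [b] the content in
    the reversed alphabet. *)
Let content (s : seq {set 'I_n}) : Prop :=
  (forall k : 'I_n, a k = count (fun C : {set 'I_n} => #|C| == k.+1) s) /\
  (forall k : 'I_n, b k = count (fun C : {set 'I_n} => rev_ord k \in C) s).

Let shape_ok (T : {ffun 'I_l -> {set 'I_n}}) : bool :=
  [forall j, #|T j| == shape j] && [forall k, b k == \sum_j (rev_ord k \in T j)]%N.

Let nth_codom (T : {ffun 'I_l -> {set 'I_n}}) (j : 'I_l) : nth set0 (codom T) j = T j.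
Proof. by rewrite codomE (nth_map j) ?size_enum_ord // nth_ord_enum. Qed.

Let codom_nth (s : seq {set 'I_n}) : size s = l -> codom [ffun j : 'I_l => nth set0 s j] = s.
Proof.
move=> sl; apply: (@eq_from_nth _ set0) => [|j]; rewrite size_codom card_ord //.
by move=> jl; rewrite (nth_codom _ (Ordinal jl)) ffunE.
Qed.

Let shape_okP (T : {ffun 'I_l -> {set 'I_n}}) :
  sorted (@col_le n) (codom T) -> all (fun C => C != set0) (codom T) ->
  reflect (content (codom T)) (shape_ok T).
Proof.
move=> sT T0.
have bE k : (\sum_j (rev_ord k \in T j) =
    count (fun C : {set 'I_n} => rev_ord k \in C) (codom T))%N.
  by rewrite -sum1_count [RHS]big_mkcond [RHS]big_image; apply: eq_bigr => j _; case: ifP.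
have szT : size (codom T) = l by rewrite size_codom card_ord.
apply: (iffP andP) => [[/forallP Ha /forallP Hb]|[Ha Hb]].
  split=> [|k]; last by rewrite -bE; apply/eqP.
  apply/column_sizes => //; split=> // j; rewrite szT => jl.
  by rewrite (nth_codom T (Ordinal jl)); apply/eqP: (Ha (Ordinal jl)).
have /column_sizes[] // := Ha => _ Hj; split; apply/forallP => k.
  by rewrite -nth_codom; apply/eqP/Hj; rewrite szT.
by rewrite bE -Hb.
Qed.

(** The first part of the shape is [l], so each of the [l] columns meets the first row. *)
Let shape_gt0 j : (j < l)%N -> (0 < shape j)%N.
Proof.
move=> jl; have n0 : (0 < n)%N.
  rewrite lt0n; apply: contraTneq jl => n0; rewrite /l big1 // => k _.
  by have := ltn_ord k; rewrite [X in (_ < X)%N]n0.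
by rewrite /shape (conj_typeP (Ordinal n0)) => [|i1 i2]; [|exact: tail_sum_mono].
Qed.

Let shape_ok_nonempty T : shape_ok T -> all (fun C => C != set0) (codom T).
Proof.
case/andP=> /forallP H _; apply/allP => _ /codomP[j ->].
by rewrite -card_gt0 (eqP (H j)) shape_gt0.
Qed.

Section Fiber.
Variables (l' : nat) (t : l'.-tuple {set 'I_n}).
Hypothesis rt : is_rSSYT t.

(** Multiplicities indexed by positions become a function of the column, which loses nothing because
    the columns of [t] are distinct. *)
Let mult (m : 'I_l' -> nat) (C : {set 'I_n}) : nat :=
  if insub (index C t) is Some j then m j else 0%N.

Let mult_tnth m j : mult m (tnth t j) = m j.
Proof.
case/andP: rt => _ ut; rewrite /mult (tnth_nth set0) index_uniq ?size_tuple //.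
by rewrite valK.
Qed.

Let sorted_t : sorted (@col_le n) t.
Proof. by case/andP: rt; rewrite is_SSYT_sorted => /andP[]. Qed.

Let nonempty_t : all (fun C => C != set0) t.
Proof. by case/andP: rt; rewrite is_SSYT_sorted => /andP[]. Qed.

Let uniq_t : uniq t. Proof. by case/andP: rt. Qed.

Let mult_okP (m : 'I_l' -> nat) :
  reflect ((forall j, 0 < m j)%N /\ content (expand t (mult m)))
    (mult_ok t (@xexp n) (@yexp n) a b m).
Proof.
have cE (p : pred {set 'I_n}) : count p (expand t (mult m)) = (\sum_(j < l') m j * p (tnth t j))%N.
  by rewrite count_expand big_tuple; apply: eq_bigr => j _; rewrite mult_tnth.
have aE k : (\sum_(j < l') m j * xexp (tnth t j) k)%N =
    count (fun C : {set 'I_n} => #|C| == k.+1) (expand t (mult m)).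
  by rewrite cE; apply: eq_bigr => j _; rewrite /xexp eq_sym.
have bE k : (\sum_(j < l') m j * yexp (tnth t j) k)%N =
    count (fun C : {set 'I_n} => rev_ord k \in C) (expand t (mult m)) by rewrite cE.
apply: (iffP andP) => [[/andP[/forallP H0 /forallP Ha] /forallP Hb]|[H0 [Ha Hb]]].
  by split=> //; split=> k; [rewrite -aE|rewrite -bE]; apply/eqP.
by split; [apply/andP; split|]; apply/forallP => k; rewrite ?aE ?bE -?Ha -?Hb.
Qed.

Let h (m : {ffun 'I_l' -> 'I_N.+1}) : {ffun 'I_l -> {set 'I_n}} :=
  [ffun j : 'I_l => nth set0 (expand t (mult (fun j => m j))) j].

(** The value fits below [N.+1]: a multiplicity is at most the number [l] of columns, and
    [l <= N]. *)
Let h' (T : {ffun 'I_l -> {set 'I_n}}) : {ffun 'I_l' -> 'I_N.+1} :=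
  [ffun j => inord (count_mem (tnth t j) (codom T))].

Let h'E T j : h' T j = count_mem (tnth t j) (codom T) :> nat.
Proof.
rewrite ffunE inordK // ltnS (leq_trans (count_size _ _)) // size_codom card_ord.
exact: leq_addr.
Qed.

Let expand_h' (T : {ffun 'I_l -> {set 'I_n}}) : sorted (@col_le n) (codom T) ->
  undup (codom T) = t ->
  expand t (mult (fun j => h' T j)) = codom T.
Proof.
move=> sT uT; rewrite -[RHS]expand_undup // uT /expand; congr flatten.
apply/eq_in_map => C /tnthP[j ->]; by rewrite mult_tnth h'E.
Qed.

Let codom_h (m : {ffun 'I_l' -> 'I_N.+1}) :
  content (expand t (mult (fun j => m j))) -> codom (h m) = expand t (mult (fun j => m j)).
Proof.
case=> Ha _; apply: codom_nth.
have [] // := proj2 (column_sizes a (expand_sorted _ sorted_t) _) Ha.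
by apply/allP => C /expand_sub; apply: (allP nonempty_t).
Qed.

(** The maps [h] and [h'] match the column sequences whose distinct columns are [t] with the
    admissible multiplicities on [t]. *)
Lemma run_length_fiber :
  \sum_(T : {ffun 'I_l -> {set 'I_n}} |
      [&& shape_ok T, sorted (@col_le n) (codom T) & undup (codom T) == t]) \prod_j w (T j) =
  \sum_(m : {ffun 'I_l' -> 'I_N.+1} | mult_ok t (@xexp n) (@yexp n) a b (fun j => val (m j)))
    \prod_(j < l') w (tnth t j) ^+ m j.
Proof.
rewrite (reindex_onto h h') /= => [|T /and3P[_ sT /eqP uT]]; last first.
  by apply/ffunP => j; rewrite ffunE expand_h' // nth_codom.
have E m : [&& shape_ok (h m), sorted (@col_le n) (codom (h m)) & undup (codom (h m)) == t]
     && (h' (h m) == m) = mult_ok t (@xexp n) (@yexp n) a b (fun j => val (m j)).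
  apply/andP/mult_okP => [[/and3P[okh sh /eqP uh] /eqP mE]|[m0 mc]].
    have eE := expand_h' sh uh; rewrite mE in eE.
    split; last by rewrite eE; apply/shape_okP => //; apply: shape_ok_nonempty.
    move=> j; rewrite -mE /= h'E -has_count has_pred1 -mem_undup uh.
    exact: mem_tnth.
  have ch := codom_h mc; have sh := expand_sorted (mult (fun j => m j)) sorted_t.
  have u : undup (expand t (mult (fun j => m j))) = t.
    by apply: undup_expand => // C /tnthP[j ->]; rewrite mult_tnth; apply: m0.
  split; last first.
    by apply/eqP/ffunP => j; apply/val_inj;
      rewrite /= h'E ch count_mem_expand ?mem_tnth // mult_tnth.
  rewrite ch sh u eqxx !andbT; apply/shape_okP; rewrite ch //.
  by apply/allP => C /expand_sub; apply: (allP nonempty_t).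
apply: eq_big => [m|m]; rewrite E // => /mult_okP[_ mc].
transitivity (\prod_(C <- codom (h m)) w C).
  by rewrite big_image.
rewrite codom_h // prod_expand big_tuple; apply: eq_bigr => j _.
by rewrite mult_tnth.
Qed.

End Fiber.

(** Column sequences are grouped by their distinct columns [t]. On each group the chain weight is
    constant, equal to [Phi t Y], and [run_length_fiber] evaluates the rest. *)
Lemma HLS_subst_coef_tab_sum :
  HLS_subst_coef Y w (@xexp n) (@yexp n) a b = tab_sum l Y shape b.
Proof.
rewrite /HLS_subst_coef -/N /tab_sum -/shape_ok.
have -> : \sum_(T : {ffun 'I_l -> {set 'I_n}} | shape_ok T)
     (\prod_(j < l | (0 < j)%N) adj_wt Y (T (opred j)) (T j)) * (\prod_j Y^-1 ^ sigma (T j)) =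
   \sum_(T : {ffun 'I_l -> {set 'I_n}} | shape_ok T && sorted (@col_le n) (codom T))
     chain_wt Y (codom T) * \prod_j w (T j).
  rewrite [RHS]big_mkcondr; apply: eq_bigr => T _; rewrite chain_wt_ffun.
  by case: ifP => // /negbT /chain_wt0 ->; rewrite mul0r.
transitivity (\sum_(T : {ffun 'I_l -> {set 'I_n}} | shape_ok T && sorted (@col_le n) (codom T))
   \sum_(l' < 2 ^ n) \sum_(t : l'.-tuple {set 'I_n} | is_rSSYT t && (undup (codom T) == t))
     chain_wt Y (codom T) * \prod_j w (T j)); last first.
  apply: eq_bigr => T /andP[okT sT]; set u := undup (codom T).
  have ru : is_rSSYT u.
    rewrite /is_rSSYT undup_uniq andbT is_SSYT_sorted; apply/andP; split; last first.
      by apply: undup_sorted sT; apply: col_le_trans.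
    by apply/allP => C; rewrite mem_undup; apply: (allP (shape_ok_nonempty okT)).
  (* Adjoining the empty set to the distinct nonempty columns still gives distinct subsets, at most
     [2 ^ n] in number. *)
  have su : (size u < 2 ^ n)%N.
    have <- : size (set0 :: u) = (size u).+1 by [].
    have u0 : uniq (set0 :: u).
      rewrite /= undup_uniq andbT; apply/negP => u0.
      by move: ru; rewrite /is_rSSYT is_SSYT_sorted => /andP[/andP[/allP/(_ _ u0)]];
        rewrite eqxx.
    rewrite -(card_uniqP u0) (leq_trans (max_card _)) //.
    by rewrite -cardsT -powersetT card_powerset cardsT card_ord.
  rewrite (bigD1 (Ordinal su)) //= [X in _ + X]big1 ?addr0; last first.
    move=> k kn; rewrite big_pred0 // => t; apply/negP => /andP[_ /eqP ut].
    by move/eqP: kn; apply; apply/val_inj; rewrite /= ut size_tuple.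
  by rewrite (big_pred1 (in_tuple u)) // => t /=; rewrite -val_eqE /= eq_sym;
    case: eqP => [->|]; rewrite ?ru ?andbF.
rewrite exchange_big /=; apply: eq_bigr => k _.
rewrite (exchange_big_dep (fun t : k.-tuple {set 'I_n} => is_rSSYT t)) /=;
  last by move=> T t _ /andP[].
apply: eq_bigr => t rt; rewrite -(run_length_fiber rt) big_distrr /=.
apply: eq_big => [T|T /and3P[_ sT /eqP uT]]; first by rewrite rt /= andbA.
by rewrite -uT Phi_chain_wt ?chain_wt_undup // undup_sorted //; apply: col_le_trans.
Qed.

End RunLength.

(** * Congruences modulo submodules of [R ^ n] *)

Definition subgroup (V : zmodType) (L : V -> Prop) : Prop :=
  L 0 /\ forall x y, L x -> L y -> L (x - y).

Definition cong (V : zmodType) (L : V -> Prop) (x y : V) : Prop := L (x - y).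

Section Subgroup.
Variables (V : zmodType) (L : V -> Prop).
Hypothesis Lsub : subgroup L.

Lemma subgroup0 : L 0. Proof. by case: Lsub. Qed.

Lemma subgroupB x y : L x -> L y -> L (x - y).
Proof. by case: Lsub => _; apply. Qed.

Lemma subgroupN x : L x -> L (- x).
Proof. by move=> Lx; rewrite -sub0r; apply: subgroupB => //; apply: subgroup0. Qed.

Lemma subgroupD x y : L x -> L y -> L (x + y).
Proof. by move=> Lx Ly; rewrite -[y]opprK; apply: subgroupB => //; apply: subgroupN. Qed.

Lemma cong_equiv : equivalence (cong L).
Proof.
split=> [x|x y|x y z]; rewrite /cong.
- by rewrite subrr; apply: subgroup0.
- by move/subgroupN; rewrite opprB.
- by move=> Lxy Lyz; rewrite -(subrKA y); apply: subgroupD.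
Qed.
End Subgroup.

(** Multiplicativity of the index: the classes modulo [M] inside a coset of [L] are a translate of
    those inside [L]. *)
Lemma class_count_tower (V : zmodType) (M L : V -> Prop) (k k' : nat) :
  subgroup M -> subgroup L -> (forall x, M x -> L x) ->
  class_count (cong M) L k -> class_count (cong L) (fun _ => True) k' ->
  class_count (cong M) (fun _ => True) (k' * k).
Proof.
move=> Msub Lsub ML cM; apply: (class_count_fiber (p := id)) => //.
- exact: cong_equiv.
- by move=> v w; apply: ML.
move=> t _; apply: (class_count_push (phi := fun x => x + t)) cM.
- exact: cong_equiv.
- by move=> x y _ _; rewrite /cong opprD addrACA subrr addr0.
- by move=> x Lx; split; rewrite /cong ?addrK.
- move=> y [_ Ly]; exists (y - t) => //.
  by rewrite /cong subrK subrr; apply: subgroup0.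
Qed.

(** * Divisibility by powers of the uniformizer and residue counts *)

Section DVR.
Variables (R : idomainType) (pi : R) (q : nat).
Hypothesis piDVR : is_DVR pi.

Definition pdvd (k : nat) (x : R) : Prop := divR (pi ^+ k) x.

Lemma pi_neq0 : pi != 0. Proof. by case: piDVR. Qed.

Lemma pdvd_pow k : pdvd k (pi ^+ k). Proof. by exists 1; rewrite mulr1. Qed.

Lemma pdvdx0 k : pdvd k 0. Proof. by exists 0; rewrite mulr0. Qed.

Lemma pdvd0 x : pdvd 0 x. Proof. by exists x; rewrite mul1r. Qed.

Lemma pdvd_subgroup k : subgroup (pdvd k).
Proof.
split; first exact: pdvdx0.
by move=> _ _ [r ->] [s ->]; exists (r - s); rewrite mulrBr.
Qed.

Lemma pdvd_mull k a x : pdvd k x -> pdvd k (a * x).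
Proof. by case=> r ->; exists (a * r); rewrite mulrCA. Qed.

Lemma pdvd_mulr k a x : pdvd k x -> pdvd k (x * a).
Proof. by rewrite mulrC; apply: pdvd_mull. Qed.

Lemma pdvd_leq k l x : (k <= l)%N -> pdvd l x -> pdvd k x.
Proof.
by move=> kl [r ->]; exists (pi ^+ (l - k) * r); rewrite mulrA -exprD subnKC.
Qed.

Lemma pdvd_mul k l x y : pdvd k x -> pdvd l y -> pdvd (k + l) (x * y).
Proof. by case=> r -> [s ->]; exists (r * s); rewrite exprD mulrACA. Qed.

Lemma pdvd_pmul k l x : pdvd (k + l) (pi ^+ k * x) <-> pdvd l x.
Proof.
split=> [[r E]|xl]; last by apply: pdvd_mul => //; apply: pdvd_pow.
exists r; apply: (mulfI (x := pi ^+ k)); first by rewrite expf_neq0 ?pi_neq0.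
by rewrite E exprD mulrA.
Qed.

Lemma pdvd1 k : pdvd k 1 -> k = 0%N.
Proof.
case: k => // k [r]; rewrite exprS => E; case: piDVR => _ /negP[].
by apply/unitrPr; exists (pi ^+ k * r); rewrite mulrA.
Qed.

Lemma pdvd_unit k s u : u \is a GRing.unit -> pdvd k (u * pi ^+ s) -> (k <= s)%N.
Proof.
move=> uU /(pdvd_mull u^-1); rewrite mulKr // => H.
have [//|sk] := leqP k s.
by move: H; rewrite -[pi ^+ s]mulr1 -(subnKC (ltnW sk)) => /pdvd_pmul/pdvd1; lia.
Qed.

Lemma pdvd_or k x :
  pdvd k x \/ exists s u, [/\ (s < k)%N, u \is a GRing.unit & x = u * pi ^+ s].
Proof.
have [->|x0] := eqVneq x 0; first by left; apply: pdvdx0.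
case: piDVR => _ _ /(_ x x0)[s [u [uU E]]].
have [ks|sk] := leqP k s; last by right; exists s, u.
by left; rewrite E; apply: pdvd_mull; apply: pdvd_leq ks (pdvd_pow _).
Qed.

Hypothesis resq : residue_card pi q.

Lemma residue_count : class_count (cong (pdvd 1)) (fun _ => True) q.
Proof.
case: resq => reps [_ inj cov]; exists (fun i : 'I_q => nth 0 reps i).
split=> // [v _|i j Eij].
  by have [i [iq vi]] := cov v; exists (Ordinal iq); rewrite /cong /pdvd expr1.
apply/val_inj/eqP; case: eqP => // ne; case: (inj i j) => //.
Qed.

Lemma q_gt1 : (1 < q)%N.
Proof.
case: residue_count => f [_ cov _].
have [i Ei] := cov 0 I; have [j Ej] := cov 1 I.
have ne : i != j.
  apply/eqP => ij; rewrite {}ij in Ei.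
  have /pdvd1 // : pdvd 1 1.
  have [_ Es Et] := cong_equiv (pdvd_subgroup 1).
  by have := Et _ _ _ Ej (Es _ _ Ei); rewrite /cong subr0.
by move: ne (ltn_ord i) (ltn_ord j); rewrite -val_eqE /=; lia.
Qed.

(** Multiplication by [pi ^+ k] identifies [o/p] with [p^k/p^(k+1)]. *)
Lemma pdvd_count k : class_count (cong (pdvd k)) (fun _ => True) (q ^ k).
Proof.
elim: k => [|k IHk].
  exists (fun i => 0); split=> // [v _|i j _]; last by rewrite [i]ord1 [j]ord1.
  by exists ord0; apply: pdvd0.
rewrite expnSr; apply: (class_count_tower _ _ _ _ IHk); try exact: pdvd_subgroup.
  by move=> x; apply: pdvd_leq.
apply: (class_count_push (phi := fun x => pi ^+ k * x)) residue_count.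
- exact/cong_equiv/pdvd_subgroup.
- by move=> x y _ _; rewrite /cong -mulrBr -[k.+1]addn1; exact: (iff_sym (pdvd_pmul _ _ _)).
- by move=> x _; apply/pdvd_mulr/pdvd_pow.
- move=> _ [r ->]; exists r => //.
  by have [E _ _] := cong_equiv (pdvd_subgroup k.+1).
Qed.

Lemma pdvd_count_in h k : (h <= k)%N ->
  class_count (cong (pdvd k)) (pdvd h) (q ^ (k - h)).
Proof.
move=> hk; apply: (class_count_push (phi := fun x => pi ^+ h * x)) (pdvd_count _).
- exact/cong_equiv/pdvd_subgroup.
- by move=> x y _ _; rewrite /cong -mulrBr -{2}(subnKC hk); exact: (iff_sym (pdvd_pmul _ _ _)).
- by move=> x _; apply/pdvd_mulr/pdvd_pow.
- move=> _ [r ->]; exists r => //.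
  by have [E _ _] := cong_equiv (pdvd_subgroup k).
Qed.

Lemma diag_subgroup n (lam : 'I_n -> nat) : subgroup (diag_sub pi lam).
Proof.
split=> [i|x y Dx Dy i]; rewrite !mxE; first exact: pdvdx0.
by apply: (subgroupB (pdvd_subgroup _)); [apply: Dx|apply: Dy].
Qed.

Lemma diag_subZ n (lam : 'I_n -> nat) a u :
  diag_sub pi lam u -> diag_sub pi lam (a *: u).
Proof. by move=> Du i; rewrite mxE; apply: pdvd_mull; apply: Du. Qed.

Lemma diag_sub_leq n (lam mu : 'I_n -> nat) u : (forall i, mu i <= lam i)%N ->
  diag_sub pi lam u -> diag_sub pi mu u.
Proof. by move=> le Du i; apply: pdvd_leq (le i) (Du i). Qed.

Lemma diag_count n (lam h : 'I_n -> nat) : (forall i, h i <= lam i)%N ->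
  class_count (cong (diag_sub pi lam)) (diag_sub pi h)
    (q ^ \sum_i (lam i - h i)).
Proof.
move=> hl; rewrite expn_sum.
have := class_count_prod (fun i => pdvd_count_in (hl i)).
case=> f [fQ fE fI]; exists f; split=> // [v /fE[i Ei]|i j Eij].
  by exists i => k; rewrite !mxE; apply: Ei.
by apply: fI => k; have := Eij k; rewrite !mxE.
Qed.

Lemma diag_count_all n (lam : 'I_n -> nat) :
  class_count (cong (diag_sub pi lam)) (fun _ => True) (q ^ \sum_i lam i).
Proof.
have := @diag_count n lam (fun => 0%N) (fun=> isT).
under eq_bigr do rewrite subn0.
by apply: class_count_ext => v; split=> // _ i; apply: pdvd0.
Qed.

(** ** The type of a lattice *)

(** The matrix of [quot_iso_type] is kept explicit, because the coordinates [u *m G] of a vector in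
    the diagonal model are used below. *)
Definition iso_via n (G : 'M[R]_n) (L : 'rV[R]_n -> Prop) (lam : 'I_n -> nat) :=
  (forall v, L v <-> diag_sub pi lam (v *m G)) /\
  (forall w, exists v, diag_sub pi lam (w - v *m G)).

Section IsoVia.
Variables (n : nat) (G : 'M[R]_n) (L : 'rV[R]_n -> Prop) (lam : 'I_n -> nat).
Hypothesis iso : iso_via G L lam.

Lemma iso_subgroup : subgroup L.
Proof.
case: iso => LE _; have D := diag_subgroup lam; split.
  by apply/LE; rewrite mul0mx; apply: (subgroup0 D).
by move=> x y /LE Lx /LE Ly; apply/LE; rewrite mulmxBl; apply: (subgroupB D).
Qed.

Lemma isoZ a v : L v -> L (a *: v).
Proof. by case: iso => LE _ /LE Lv; apply/LE; rewrite -scalemxAl; apply: diag_subZ. Qed.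

(** [G] is onto modulo [diag_sub pi lam], so counts in the diagonal model pull back to [o^n]. *)
Lemma iso_pull (D Q : 'rV[R]_n -> Prop) k :
  subgroup D -> (forall x, diag_sub pi lam x -> D x) ->
  (forall x y, D (x - y) -> Q x -> Q y) ->
  class_count (cong D) Q k ->
  class_count (cong (fun v => D (v *m G))) (fun v => Q (v *m G)) k.
Proof.
case: iso => _ onto Dsub Dlam Qinv.
apply: (class_count_pull (phi := fun v => v *m G)) => //.
- exact: cong_equiv.
- by move=> x y _ _; rewrite /cong mulmxBl.
- move=> y Qy; have [v Dv] := onto y; exists v; last exact: Dlam.
  by apply: Qinv Qy; apply: Dlam.
Qed.

(** The module [L + pi^j o^n]; the lengths of the quotients by these modules determine the type of
    [L]. *)
Definition thicken (j : nat) (v : 'rV[R]_n) : Prop := exists w, L (v - pi ^+ j *: w).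

Lemma thickenE j v :
  thicken j v <-> diag_sub pi (fun i => minn (lam i) j) (v *m G).
Proof.
case: iso => LE onto; split=> [[w /LE Dw] i|Dv].
  have -> : v *m G = (v - pi ^+ j *: w) *m G + pi ^+ j *: (w *m G).
    by rewrite mulmxBl -scalemxAl subrK.
  rewrite mxE; apply: (subgroupD (pdvd_subgroup _)).
    by apply: pdvd_leq (geq_minl _ _) (Dw i).
  rewrite mxE; apply: pdvd_mulr; apply: pdvd_leq (geq_minr _ _) (pdvd_pow _).
(* Modulo the diagonal module [v *m G] is a multiple of [pi ^+ j]: coordinates with [lam i <= j]
   vanish there and the others are divisible by [pi ^+ j]. *)
have [e eE] : exists e : 'rV[R]_n, diag_sub pi lam (v *m G - pi ^+ j *: e).
  have /fin_all_exists[e eP] : forall i, exists x, pdvd (lam i) ((v *m G) 0 i - pi ^+ j * x).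
    move=> i; have [le|lt] := leqP (lam i) j.
      exists 0; rewrite mulr0 subr0; have := Dv i; by rewrite (minn_idPl le).
    have := Dv i; rewrite (minn_idPr (ltnW lt)) => -[r ->]; exists r.
    by rewrite subrr; apply: pdvdx0.
  by exists (\row_i e i) => i; have := eP i; rewrite !mxE.
have [w wE] := onto e; exists w; apply/LE.
have -> : (v - pi ^+ j *: w) *m G =
    (v *m G - pi ^+ j *: e) + pi ^+ j *: (e - w *m G).
  by rewrite mulmxBl -scalemxAl scalerBr addrA subrK.
by apply: (subgroupD (diag_subgroup lam)) => //; apply: diag_subZ.
Qed.

Lemma thicken_subgroup j : subgroup (thicken j).
Proof.
have D := diag_subgroup (fun i => minn (lam i) j); split.
  by apply/thickenE; rewrite mul0mx; apply: (subgroup0 D).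
by move=> x y /thickenE Lx /thickenE Ly; apply/thickenE; rewrite mulmxBl; apply: (subgroupB D).
Qed.

Lemma thicken_count j :
  class_count (cong (thicken j)) (fun _ => True) (q ^ \sum_i minn (lam i) j).
Proof.
have c := diag_count_all (fun i => minn (lam i) j).
have [||f [fQ fE fI]] := iso_pull (diag_subgroup _) _ _ c => //.
  by move=> x; apply: diag_sub_leq => i; apply: geq_minl.
exists f; split=> // [v _|i j' Eij].
  by have [i Ei] := fE v I; exists i; apply: (proj2 (thickenE j _) Ei).
by apply: fI; apply: (proj1 (thickenE j _) Eij).
Qed.

End IsoVia.

(** ** One-step extensions of lattices *)

(** The submodule generated by [0 + L] and the row [(pi ^+ e, u)]. *)
Definition ext n (L : 'rV[R]_n -> Prop) (e : nat) (u : 'rV[R]_n) (z : 'rV[R]_(1 + n)) :=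
  exists c, lsubmx z 0 0 = c * pi ^+ e /\ L (rsubmx z - c *: u).

(** [level mu w j r] says that [pi ^ (j - r) * w] lies in [pi ^ j H] for
    [H = sum_i o / p ^ (mu i)]; hence the exponent by which [ext] increases the
    length of [o ^ n / (L + pi ^ j o ^ n)] is the largest [r <= min j e] with
    this property. *)
Definition level n (mu : 'I_n -> nat) (w : 'rV[R]_n) (j r : nat) : Prop :=
  forall i, pdvd (r - (j - mu i)) (w 0 i).

Definition max_level n (mu : 'I_n -> nat) (w : 'rV[R]_n) (e j r : nat) : Prop :=
  [/\ (r <= minn j e)%N, level mu w j r & (r < minn j e)%N -> ~ level mu w j r.+1].

Section Extension.
Variables (n : nat) (G : 'M[R]_n) (L : 'rV[R]_n -> Prop) (mu : 'I_n -> nat).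
Hypothesis iso : iso_via G L mu.
Variables (e : nat) (u : 'rV[R]_n).

(** The module [(0 + L) + pi^j o^(1+n)]; adding the multiples of [gen] yields the thickening of the
    extension. *)
Let split_thick j (z : 'rV[R]_(1 + n)) := pdvd j (lsubmx z 0 0) /\ thicken L j (rsubmx z).

Let gen : 'rV[R]_(1 + n) := row_mx (pi ^+ e)%:M u.

Let split_thick_subgroup j : subgroup (split_thick j).
Proof.
have Dp := pdvd_subgroup j; have Dt := thicken_subgroup iso j; split.
  by split; rewrite ?linear0 ?mxE; [apply: (subgroup0 Dp)|apply: (subgroup0 Dt)].
move=> x y [px tx] [py ty]; split; rewrite linearB ?mxE.
  by move: px py; rewrite !mxE => px py; apply: (subgroupB Dp).
exact: (subgroupB Dt).
Qed.

Let split_thick_count j :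
  class_count (cong (split_thick j)) (fun _ => True) (q ^ (j + \sum_i minn (mu i) j)).
Proof.
pose kap (i : 'I_(1 + n)) := match split i with inl _ => j | inr i => minn (mu i) j end.
have kapE z : diag_sub pi kap z <->
    pdvd j (lsubmx z 0 0) /\ diag_sub pi (fun i => minn (mu i) j) (rsubmx z).
  split=> [Dz|[Dl Dr] i].
    split=> [|i]; rewrite mxE.
      by have := Dz (lshift n 0); rewrite /kap -/(unsplit (inl 0)) unsplitK.
    by have := Dz (rshift 1 i); rewrite /kap -/(unsplit (inr i)) unsplitK.
  rewrite /kap; case: splitP => k ik.
    have -> : i = lshift n 0 by apply/val_inj; rewrite /= ik [k]ord1.
    by move: Dl; rewrite mxE.
  have -> : i = rshift 1 k by apply/val_inj; rewrite /= ik.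
  by have := Dr k; rewrite mxE.
have <- : (\sum_i kap i = j + \sum_i minn (mu i) j)%N.
  rewrite big_split_ord big_ord1 /kap -/(unsplit (inl ord0)) unsplitK; congr (_ + _)%N.
  by apply: eq_bigr => i _; rewrite -/(unsplit (inr i)) unsplitK.
apply: (class_count_pull (phi := fun z : 'rV[R]_(1 + n) => row_mx (lsubmx z) (rsubmx z *m G)))
  (diag_count_all kap) => //.
- exact/cong_equiv/diag_subgroup.
- move=> x y _ _; rewrite /cong opp_row_mx add_row_mx -mulmxBl -!linearB.
  split=> [[Dl /(thickenE iso)]|/kapE []]; rewrite ?row_mxKl ?row_mxKr.
    by move=> Dr; apply/kapE; rewrite row_mxKl row_mxKr.
  by move=> Dl /(thickenE iso).
- move=> y _; have [_ onto] := iso; have [v Dv] := onto (rsubmx y).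
  exists (row_mx (lsubmx y) v) => //; apply/kapE.
  rewrite !row_mxKl !row_mxKr !linearB /= !row_mxKl !row_mxKr subrr mxE; split.
    exact: pdvdx0.
  by apply: diag_sub_leq Dv => i; apply: geq_minl.
Qed.

Let thicken_ext j z :
  thicken (ext L e u) j z <-> exists c, split_thick j (z - c *: gen).
Proof.
have lgen c : lsubmx (c *: gen) 0 0 = c * pi ^+ e.
  by rewrite linearZ /= row_mxKl !mxE eqxx mulr1n.
have rgen c : rsubmx (c *: gen) = c *: u by rewrite linearZ /= row_mxKr.
have lB (x y : 'rV[R]_(1 + n)) : lsubmx (x - y) 0 0 = lsubmx x 0 0 - lsubmx y 0 0.
  by rewrite linearB !mxE.
have rB (x y : 'rV[R]_(1 + n)) : rsubmx (x - y) = rsubmx x - rsubmx y by rewrite linearB.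
split=> [[w [c []]]|[c []]].
  rewrite lB rB /= => /eqP; rewrite subr_eq => /eqP E1 E2.
  exists c; split; rewrite ?lB ?rB ?lgen ?rgen.
    rewrite E1 addrAC subrr add0r linearZ /= mxE.
    exact/pdvd_mulr/pdvd_pow.
  by exists (rsubmx w); rewrite addrAC; move: E2; rewrite linearZ.
rewrite lB lgen rB rgen => -[r E1] [w E2].
exists (row_mx r%:M w), c; split.
  by rewrite lB linearZ /= row_mxKl [X in _ - X]mxE [r%:M _ _]mxE eqxx mulr1n -E1 subKr.
by rewrite rB linearZ /= row_mxKr addrAC.
Qed.

(** The quotient by [split_thick j] has length [j + \sum_i minn (mu i) j]. The thickened extension
    is cyclic over [split_thick j], generated by [gen], of length [j - r]; the difference of the two
    lengths is the left side. *)
Lemma ext_length (G' : 'M[R]_(1 + n)) (lam : 'I_(1 + n) -> nat) (j r : nat) :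
  iso_via G' (ext L e u) lam -> max_level mu (u *m G) e j r ->
  (\sum_i minn (lam i) j = \sum_i minn (mu i) j + r)%N.
Proof.
move=> iso'; rewrite /max_level leq_min => -[/andP[rj re] lev lev'].
(* The annihilator of [gen] modulo [split_thick j] is the ideal generated by [pi ^+ (j - r)]. *)
have gen_thick c : split_thick j (c *: gen) <-> pdvd (j - r) c.
  rewrite /split_thick linearZ /= row_mxKl linearZ /= row_mxKr !mxE eqxx mulr1n.
  split=> [[Dl /(thickenE iso) Dr]|pc].
    have [//|[s [a [sj aU cE]]]] := pdvd_or (j - r) c.
    (* A multiplier of valuation [s < j - r] would force [j <= s + e], hence [r < minn j e], and
       also level [r.+1], against maximality. *)
    case: lev'; first by move: Dl; rewrite cE -mulrA -exprD => /(pdvd_unit aU); lia.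
    move=> i; have := Dr i; rewrite -scalemxAl mxE cE -mulrA => /(pdvd_mull a^-1).
    rewrite mulKr // => Dw.
    have [rj'|jr] := leqP r.+1 (j - mu i).
      by rewrite (eqP (rj' : r.+1 - _ == 0)%N); apply: pdvd0.
    by apply/(pdvd_pmul s); apply: pdvd_leq Dw; move: jr; case: (leqP (mu i) j); lia.
  split; first by apply: pdvd_leq (pdvd_mul pc (pdvd_pow e)); lia.
  apply/(thickenE iso) => i; rewrite -scalemxAl mxE.
  by apply: pdvd_leq (pdvd_mul pc (lev i)); case: (leqP (mu i) j); lia.
have c1 : class_count (cong (split_thick j)) (thicken (ext L e u) j) (q ^ (j - r)).
  apply: (class_count_push (phi := fun c => c *: gen)) (pdvd_count (j - r)).
  - exact/cong_equiv/split_thick_subgroup.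
  - by move=> x y _ _; rewrite /cong -scalerBl; apply: iff_sym.
  - move=> c _; apply/thicken_ext; exists c; rewrite subrr.
    exact: (subgroup0 (split_thick_subgroup j)).
  - by move=> z /thicken_ext[c Dc]; exists c.
have sub x : split_thick j x -> thicken (ext L e u) j x.
  by move=> Dx; apply/thicken_ext; exists 0; rewrite scale0r subr0.
have := class_count_tower (split_thick_subgroup j) (thicken_subgroup iso' j) sub c1
  (thicken_count iso' j).
move/(class_count_uniq (cong_equiv (split_thick_subgroup j)) (split_thick_count j))/eqP.
by rewrite -expnD eqn_exp2l ?q_gt1 //; lia.
Qed.

End Extension.

(** ** Horizontal strips *)

Lemma sum_minnS n (lam : 'I_n -> nat) j :
  (\sum_i minn (lam i) j.+1 = \sum_i minn (lam i) j + conj_type lam j)%N.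
Proof.
rewrite -big_split /=; apply: eq_bigr => i _.
by case: (ltnP j (lam i)); lia.
Qed.

(** The number of boxes of the strip in its first [j] columns. *)
Definition partial (th : nat -> bool) (j : nat) : nat := (\sum_(i < j) th i)%N.

Lemma partialS th j : partial th j.+1 = (partial th j + th j)%N.
Proof. by rewrite /partial big_ord_recr. Qed.

Lemma partial0 th : partial th 0 = 0%N. Proof. by rewrite /partial big_ord0. Qed.

Lemma partial_leqD th j k : (partial th j <= partial th (j + k) <= partial th j + k)%N.
Proof.
elim: k => [|k IHk]; first by rewrite !addn0 leqnn.
by rewrite addnS partialS; case: (th _); lia.
Qed.

Lemma partial_leq th j k : (j <= k)%N ->
  (partial th j <= partial th k <= partial th j + (k - j))%N.
Proof. by move=> jk; have := partial_leqD th j (k - j); rewrite subnKC. Qed.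

Lemma partial_leq_id th j : (partial th j <= j)%N.
Proof. by have := partial_leqD th 0 j; rewrite partial0 add0n; lia. Qed.

Lemma sum_minn_partial n m (lam : 'I_n -> nat) (mu : 'I_m -> nat)
    (th : nat -> bool) :
  (forall j, conj_type lam j = conj_type mu j + th j)%N ->
  forall j, (\sum_i minn (lam i) j = \sum_i minn (mu i) j + partial th j)%N.
Proof.
move=> lm; elim=> [|j IHj]; last by rewrite !sum_minnS IHj lm partialS; lia.
by rewrite partial0 !big1 // => i _; rewrite minn0.
Qed.

Lemma descent_up (th : nat -> bool) j m : (0 < j)%N -> ~~ th j.-1 ->
  (partial th j < partial th (j + m))%N ->
  exists d, [/\ descent th d, (j <= d)%N & partial th d = partial th j].
Proof.
elim: m j => [|m IHm] j j0 nth; first by rewrite addn0 ltnn.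
have [tj _|ntj] := boolP (th j); first by exists j; rewrite /descent j0 nth.
rewrite addnS -addSn => lt; have := IHm j.+1 isT ntj.
rewrite partialS (negPf ntj) addn0 => /(_ lt)[d [dd jd pd]].
by exists d; split=> //; apply: ltnW.
Qed.

Lemma descent_down (th : nat -> bool) j : th j -> (partial th j.+1 < j.+1)%N ->
  exists d, [/\ descent th d, (d <= j)%N & partial th j.+1 = (partial th d + (j.+1 - d))%N].
Proof.
elim: j => [|j IHj] tj; first by rewrite partialS tj addn1.
rewrite partialS tj => lt; have [tj'|ntj] := boolP (th j).
  have [|d [dd dj pd]] := IHj tj'; first by lia.
  by exists d; split=> //; rewrite ?pd; lia.
by exists j.+1; rewrite /descent tj ntj; split=> //; lia.
Qed.

(** Some column before [j] is free and some column from [j] on carries a box. So either [th] is 0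
    from [j] up to the next descent, or it is 1 from the last descent up to [j]. *)
Lemma descent_ex th e l j :
  (forall k, (l <= k)%N -> partial th k = e) -> (partial th j < minn j e)%N ->
  exists2 d, descent th d &
    ((j <= d)%N /\ partial th d = partial th j) \/
    ((d <= j)%N /\ partial th j = (partial th d + (j - d))%N).
Proof.
move=> pe; rewrite leq_min => /andP[pj pje].
case: j pj pje => // j pj pje; have [tj|ntj] := boolP (th j).
  have [d [dd dj pd]] := descent_down tj pj.
  by exists d => //; right; split=> //; apply: leqW.
have [|d [dd jd pd]] := @descent_up th j.+1 l isT ntj; last by exists d => //; left.
by rewrite (pe (j.+1 + l)%N) ?leq_addl.
Qed.

Section Levels.
Variables (n : nat) (mu : 'I_n -> nat) (w : 'rV[R]_n) (e : nat).

Lemma level_leq j r r' : (r <= r')%N -> level mu w j r' -> level mu w j r.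
Proof. by move=> rr lev i; apply: pdvd_leq (lev i); lia. Qed.

Lemma max_level_ex j : exists r, max_level mu w e j r.
Proof.
suff H k : exists r, [/\ (r <= k)%N, level mu w j r & (r < k)%N -> ~ level mu w j r.+1].
  exact: H (minn j e).
elim: k => [|k [r [rk lr nlr]]]; first by exists 0%N; split=> // i; apply: pdvd0.
have [lk|nlk] := classic (level mu w j k.+1).
  by exists k.+1; split=> //; rewrite ltnn.
exists r; split=> //; first exact: leqW.
by move=> rk1; move: rk; rewrite leq_eqVlt => /orP[/eqP->|/nlr].
Qed.

Lemma max_level_uniq j r r' : max_level mu w e j r -> max_level mu w e j r' -> r = r'.
Proof.
move=> [le1 lev1 max1] [le2 lev2 max2]; case: (ltngtP r r') => // lt.
  by case: max1; [apply: leq_trans lt le2|apply: level_leq lt lev2].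
by case: max2; [apply: leq_trans lt le1|apply: level_leq lt lev1].
Qed.

(** Passing from [j] to [j.+1] relaxes each divisibility by at most one power of [pi]; hence the
    increments of the maximal level are the bits of a horizontal strip. *)
Lemma max_levelS j r r' : max_level mu w e j r -> max_level mu w e j.+1 r' ->
  (r <= r' <= r.+1)%N.
Proof.
move=> [le1 lev1 max1] [le2 lev2 max2]; apply/andP; split; rewrite leqNgt; apply/negP => lt.
  apply: max2; first by move: lt le1; rewrite !leq_min; lia.
  apply: level_leq lt _ => i; apply: pdvd_leq (lev1 i); lia.
apply: max1; first by move: lt le2; rewrite !leq_min; lia.
move=> i; apply: pdvd_leq (lev2 i); lia.
Qed.

(** [partial th] is monotone and grows by at most 1 per step, so the level conditions for all [j]
    reduce to one valuation bound per coordinate, attained in the block [mu i = d] at each descent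
    [d]. *)
Lemma max_level_partial (th : nat -> bool) l :
  (forall k, (l <= k)%N -> partial th k = e) ->
  (forall j, max_level mu w e j (partial th j)) <->
  diag_sub pi (fun i => partial th (mu i)) w /\
  (forall d, descent th d -> exists i, mu i = d /\ ~ pdvd (partial th d).+1 (w 0 i)).
Proof.
move=> pe; split=> [lev|[Dw des] j].
  have Dw i : pdvd (partial th (mu i)) (w 0 i).
    by have [_ /(_ i)] := lev (mu i); rewrite subnn subn0.
  split=> // d /and3P[d0 nth1 th1]; have [_ _] := lev d.
  have pS := partialS th d.-1; rewrite prednK // (negPf nth1) addn0 in pS.
  have lt : (partial th d < minn d e)%N.
    rewrite leq_min; have := partial_leq_id th d.-1; rewrite -pS => le.
    have := partial_leq th (leq_maxr l d.+1); rewrite (pe (maxn _ _)) ?leq_maxl // partialS th1.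
    by lia.
  move=> /(_ lt) nlev; have [i ni] : exists i, ~ pdvd ((partial th d).+1 - (d - mu i)) (w 0 i).
    by apply: NNPP => H; apply: nlev => i; apply: NNPP => H'; apply: H; exists i.
  exists i; have lt' : (partial th (mu i) < (partial th d).+1 - (d - mu i))%N.
    by rewrite ltnNge; apply/negP => H; apply: ni; apply: pdvd_leq H (Dw i).
  (* Other blocks are excluded: for [mu i < d] the free column [d.-1] makes the known bound strong
     enough, and for [d < mu i] the box in column [d] does. *)
  suff mud : mu i = d by split=> //; move: ni; rewrite mud subnn subn0.
  case: (ltngtP (mu i) d) => // H.
    have := @partial_leq th (mu i) d.-1; rewrite -pS; lia.
  by have := partial_leq th H; rewrite partialS th1; lia.
have le : (partial th j <= minn j e)%N.
  rewrite leq_min partial_leq_id /=.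
  by have := partial_leq th (leq_maxr l j); rewrite (pe (maxn _ _)) ?leq_maxl //; lia.
split=> // [i|lt lev].
  apply: pdvd_leq (Dw i); have [mj|/ltnW jm] := leqP (mu i) j.
    by have := partial_leq th mj; lia.
  by have := partial_leq th jm; lia.
(* A higher level at [j] would add a factor [pi] to every coordinate in the block of this
   descent. *)
have [d dd dj] := descent_ex pe lt; have [i [mi []]] := des d dd.
by apply: pdvd_leq (lev i); rewrite mi; case: dj => -[]; lia.
Qed.

End Levels.

Section ExtType.
Variables (n : nat) (G : 'M[R]_n) (L : 'rV[R]_n -> Prop) (mu : 'I_n -> nat).
Hypothesis iso : iso_via G L mu.
Variables (e : nat) (u : 'rV[R]_n) (G' : 'M[R]_(1 + n)) (lam : 'I_(1 + n) -> nat).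
Hypothesis iso' : iso_via G' (ext L e u) lam.

(** By [ext_length] the maximal level at [j] is the difference of the truncated sums, whose
    increments in [j] are the conjugate parts. *)
Lemma ext_conj_type (th : nat -> bool) :
  (forall j, conj_type lam j = conj_type mu j + th j)%N <->
  (forall j, max_level mu (u *m G) e j (partial th j)).
Proof.
split=> [lm j|lev j].
  have [r lev] := max_level_ex mu (u *m G) e j.
  have := ext_length iso iso' lev; rewrite (sum_minn_partial lm).
  by move/addnI ->.
have := ext_length iso iso' (lev j.+1); rewrite !sum_minnS partialS.
by rewrite (ext_length iso iso' (lev j)); lia.
Qed.

Lemma ext_strip_ex : exists th : nat -> bool,
  forall j, (conj_type lam j = conj_type mu j + th j)%N.
Proof.
have [r rP] := functional_choice (max_level_ex mu (u *m G) e).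
exists (fun j => r j != r j.+1); apply/ext_conj_type => j.
suff -> : partial (fun j => r j != r j.+1) j = r j by [].
elim: j => [|j IHj].
  by rewrite partial0; have [] := rP 0%N; rewrite min0n; lia.
by rewrite partialS IHj /=; have := max_levelS (rP j) (rP j.+1); case: eqP => /=; lia.
Qed.

Lemma ext_strip_size (th : nat -> bool) l :
  (forall j, conj_type lam j = conj_type mu j + th j)%N ->
  (forall j, (l <= j)%N -> conj_type lam j = 0%N) ->
  forall j, (l <= j)%N -> partial th j = e.
Proof.
move=> lm lam0.
have th0 j : (l <= j)%N -> th j = false.
  by move/lam0; rewrite lm => /eqP; rewrite addn_eq0 => /andP[_]; case: (th j).
have mul i : (mu i <= l)%N.
  rewrite leqNgt; apply/negP => lt; have := lm l.
  by rewrite lam0 // /conj_type (bigD1 i) //= lt.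
have pconst k : partial th (l + k) = partial th l.
  elim: k => [|k IHk]; first by rewrite addn0.
  by rewrite addnS partialS IHk th0 ?leq_addr // addn0.
(* At [l + e] the level condition for [e] is vacuous, since all [mu i <= l], so the maximal level
   there is [e]. *)
move=> j lj; rewrite -(subnKC lj) pconst -(pconst e).
apply: (max_level_uniq (proj1 (ext_conj_type th) lm (l + e)%N)); split.
- by rewrite leq_min leq_addl leqnn.
- by move=> i; apply: pdvd_leq (pdvd0 _); have := mul i; lia.
- by rewrite leq_min ltnn andbF.
Qed.
End ExtType.

(** * Counting the tails that produce a given strip *)

Let qr_neq0 : (q%:R : rat) != 0.
Proof. by rewrite pnatr_eq0 -lt0n; apply: ltnW q_gt1. Qed.

Lemma sum_ltn_not (th : nat -> bool) l m : (m <= l)%N ->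
  (\sum_(j < l | ~~ th j) (j < m) = m - partial th m)%N.
Proof.
move=> ml; rewrite /partial.
have -> : (\sum_(j < l | ~~ th j) (j < m) = \sum_(j < m) ~~ th j)%N.
  rewrite big_mkcond (big_ord_widen_cond l xpredT (fun j => nat_of_bool (~~ th j))) //=.
  by rewrite [RHS]big_mkcond; apply: eq_bigr => j _; case: (th j); case: (_ < _)%N.
suff : (\sum_(j < m) ~~ th j + \sum_(j < m) th j = m)%N by lia.
rewrite -big_split /= -[RHS]card_ord -sum1_card; apply: eq_bigr => j _.
by case: (th j).
Qed.

(** Each further [d] in [S] removes the vectors all of whose [d]-block entries
    have one more factor [pi], a proportion [q ^ - (size of the block)]. *)
Lemma block_count n (mu g : 'I_n -> nat) (S : seq nat) :
  uniq S -> (forall i, g i <= mu i)%N -> (forall i, mu i \in S -> g i < mu i)%N ->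
  exists k, class_count (cong (diag_sub pi mu))
      (fun w => diag_sub pi g w /\
         forall d, d \in S -> exists i, mu i = d /\ ~ pdvd (g i).+1 (w 0 i)) k /\
    (k%:R : rat) = q%:R ^+ (\sum_i (mu i - g i)) *
       \prod_(d <- S) (1 - q%:R^-1 ^+ (\sum_i (mu i == d))).
Proof.
elim: S g => [|d S IHS] g /=.
  move=> _ gmu _; exists (q ^ \sum_i (mu i - g i))%N; split;
    last by rewrite big_nil mulr1 natrX.
  by apply: class_count_ext (diag_count gmu) => v; split=> [|[]].
case/andP=> dS uS gmu gS.
have gS' i : mu i \in S -> (g i < mu i)%N by move=> iS; apply: gS; rewrite inE iS orbT.
(* Raising the bound by one on block [d] describes the vectors that violate the condition at [d];
   the induction hypothesis applies to both bounds. *)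
pose g' i := (g i + (mu i == d))%N.
have g'mu i : (g' i <= mu i)%N.
  rewrite /g'; case: eqP => [E|_]; last by rewrite addn0.
  by rewrite addn1 gS // inE E eqxx.
have g'E i : mu i \in S -> g' i = g i.
  move=> iS; rewrite /g'; case: eqP => [E|_]; last by rewrite addn0.
  by move: dS; rewrite -E iS.
have [k [ck kE]] := IHS g uS gmu gS'.
have [|k1 [ck1 k1E]] := IHS g' uS g'mu; first by move=> i iS; rewrite g'E ?gS'.
have Dmu := diag_subgroup mu.
have Q1E (w : 'rV[R]_n) : (diag_sub pi g' w /\
     forall d, d \in S -> exists i, mu i = d /\ ~ pdvd (g' i).+1 (w 0 i)) <->
   ((diag_sub pi g w /\
     forall d, d \in S -> exists i, mu i = d /\ ~ pdvd (g i).+1 (w 0 i)) /\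
     forall i, mu i = d -> pdvd (g i).+1 (w 0 i)).
  split=> [[D' H']|[[D H] Hd]].
    split; [split|].
    - by apply: diag_sub_leq D' => i; apply: leq_addr.
    - by move=> d' d'S; have [i [Ei]] := H' d' d'S; rewrite g'E ?Ei // => ?; exists i.
    - by move=> i Ei; have := D' i; rewrite /g' Ei eqxx addn1.
  split=> [i|d' d'S].
    by rewrite /g'; case: eqP => [/Hd|_]; rewrite ?addn1 // addn0; apply: D.
  by have [i [Ei]] := H d' d'S; exists i; rewrite g'E ?Ei.
have pinv (a : nat) (v w : 'rV[R]_n) i : diag_sub pi mu (v - w) -> (a <= mu i)%N ->
    pdvd a (v 0 i) -> pdvd a (w 0 i).
  move=> Dvw ai pv; have := Dvw i; rewrite !mxE => pvw.
  by rewrite -[w 0 i](subKr (v 0 i)); apply: (subgroupB (pdvd_subgroup a)) => //;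
    apply: pdvd_leq pvw.
have [||k1k cd] := class_count_diff (cong_equiv Dmu) _ _ ck ck1.
- move=> v w Dvw [Dv H]; split=> [i|d' d'S]; first exact: pinv Dvw (g'mu i) (Dv i).
  have [i [Ei ni]] := H d' d'S; exists i; split=> // pw; apply: ni.
  apply: pinv pw; last by rewrite g'E ?gS' ?Ei.
  by have [_ Es _] := cong_equiv Dmu; apply: Es.
- by move=> v /Q1E[].
exists (k - k1)%N; split.
  apply: class_count_ext cd => v; split=> [[[D H] nQ1]|[D H]].
    split=> // d'; rewrite inE => /orP[/eqP->|/H //].
    apply: NNPP => nex; apply: nQ1; apply/Q1E; split=> // i Ei.
    by apply: NNPP => np; apply: nex; exists i.
  have H' d' : d' \in S -> exists i, mu i = d' /\ ~ pdvd (g i).+1 (v 0 i).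
    by move=> d'S; apply: H; rewrite inE d'S orbT.
  split=> // /Q1E[_ Hd]; have [i [Ei]] := H d (mem_head _ _).
  by case; apply: Hd.
rewrite natrB // kE k1E big_cons.
have -> : (\sum_i (mu i - g i) = \sum_i (mu i - g' i) + \sum_i (mu i == d))%N.
  rewrite -big_split; apply: eq_bigr => i _ /=; have := g'mu i; rewrite /g'; lia.
rewrite exprD exprVn; set a := _ ^+ _; set b := q%:R ^+ _; set c := \prod_(_ <- _) _.
have : b != 0 by rewrite expf_neq0.
by move=> b0; field.
Qed.

Lemma level_cong n (mu : 'I_n -> nat) (x y : 'rV[R]_n) j r : (r <= j)%N ->
  diag_sub pi mu (x - y) -> level mu x j r -> level mu y j r.
Proof.
move=> rj Dxy lev i; have := Dxy i; rewrite !mxE => pxy.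
rewrite -[y 0 i](subKr (x 0 i)); apply: (subgroupB (pdvd_subgroup _)) => //.
by apply: pdvd_leq pxy; lia.
Qed.

Lemma max_level_cong n (mu : 'I_n -> nat) (x y : 'rV[R]_n) e j r :
  diag_sub pi mu (x - y) -> max_level mu x e j r -> max_level mu y e j r.
Proof.
move=> Dxy [le lev nlev]; split=> //.
  by apply: level_cong Dxy lev; move: le; rewrite leq_min => /andP[].
move=> lt; have := nlev lt => nx ny; apply: nx; apply: level_cong ny.
  by move: lt; rewrite leq_min => /andP[].
by have [_ Es _] := cong_equiv (diag_subgroup mu); apply: Es.
Qed.

(** The level conditions become those of [block_count] with [g i = partial th (mu i)], and the count
    is carried from the diagonal model to [o^n] modulo [L] along [G]. *)
Lemma strip_count n (G : 'M[R]_n) L mu (th : nat -> bool) l e :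
  iso_via G L mu -> (forall i, mu i <= l)%N ->
  (forall k, (l <= k)%N -> partial th k = e) ->
  exists k, class_count (cong L)
      (fun u => forall j, max_level mu (u *m G) e j (partial th j)) k /\
    (k%:R : rat) = strip_wt l q%:R^-1 (conj_type mu) th.
Proof.
move=> iso mul pe; pose S := [seq d <- iota 0 l | descent th d].
have [|||k [ck kE]] := @block_count n mu (fun i => partial th (mu i)) S.
- exact/filter_uniq/iota_uniq.
- by move=> i; apply: partial_leq_id.
- move=> i; rewrite mem_filter => /andP[/and3P[d0 nth1 _] _].
  have := partialS th (mu i).-1; rewrite prednK // (negPf nth1) addn0 => ->.
  by rewrite -[X in (_ < X)%N](prednK d0) ltnS partial_leq_id.
have dl d : descent th d -> (d < l)%N.
  case/and3P=> _ _ td; rewrite ltnNge; apply/negP => ld.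
  by have := pe d.+1 (leqW ld); rewrite partialS pe // td; lia.
have QE (w : 'rV[R]_n) : (forall j, max_level mu w e j (partial th j)) <->
   (diag_sub pi (fun i => partial th (mu i)) w /\
         forall d, d \in S -> exists i, mu i = d /\ ~ pdvd (partial th (mu i)).+1 (w 0 i)).
  apply: iff_trans (max_level_partial mu w pe) _.
  split=> -[D H]; split=> // d.
    rewrite mem_filter => /andP[/H[i [Ei ni]] _].
    by exists i; rewrite Ei.
  move=> dd; have [|i [Ei ni]] := H d.
    by rewrite mem_filter dd mem_iota add0n dl.
  by exists i; rewrite -Ei.
exists k; split.
  have [LE _] := iso.
  have [||f [fQ fE fI]] := iso_pull iso (diag_subgroup mu) _ _
    (class_count_ext (fun w => iff_sym (QE w)) ck) => //.
    by move=> x y Dxy lev j; apply: max_level_cong Dxy (lev j).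
  exists f; split=> // [v Qv|i j Eij].
    by have [i Ei] := fE v Qv; exists i; apply/LE.
  by apply: fI; apply/LE.
rewrite kE /strip_wt; congr (_ * _).
  (* [mu i - partial th (mu i)] counts the free columns before [mu i]; exchanging the sums gives
     conjugate parts over free columns. *)
  rewrite invrK -(big_morph _ (exprD _) (expr0 _)); congr (_ ^+ _).
  rewrite [RHS](eq_bigr (fun j : 'I_l => \sum_i (j < mu i)))%N //.
  rewrite exchange_big /=; apply: eq_bigr => i _; apply/esym.
  exact: sum_ltn_not.
rewrite big_filter -[in LHS](subn0 l) -/(index_iota 0 l) big_mkord.
apply: eq_bigr => j /and3P[j0 _ _]; congr (1 - _ ^+ _).
(* The block [mu i = j] has as many indices as the conjugate drops from [j.-1] to [j]. *)
rewrite /conj_type -sumnB => [|i _]; last by case: (ltnP j (mu i)); lia.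
by apply: eq_bigr => i _; rewrite -(prednK j0) /=; case: ltngtP; lia.
Qed.

(** ** Smith normal form and Hermite bases *)

Lemma min_val_entry m n (M : 'M[R]_(m, n)) : M != 0 ->
  exists i j s a, [/\ a \is a GRing.unit, M i j = a * pi ^+ s &
    forall i' j', pdvd s (M i' j')].
Proof.
move=> M0; have [i [j Mij]] : exists i j, M i j != 0.
  apply: NNPP => H; case/eqP: M0; apply/matrixP => i j; rewrite mxE.
  by apply/eqP; apply: contraT => ne; case: H; exists i, j.
pose P k := holds (exists i j, ~ pdvd k.+1 (M i j)).
have exP : exists k, P k.
  have [_ _ /(_ _ Mij)[k [a [aU E]]]] := piDVR.
  by exists k; apply/holdsP; exists i, j; rewrite E => /(pdvd_unit aU); rewrite ltnn.
case: (ex_minnP exP) => s /holdsP[i0 [j0 np]] smin.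
have ps i' j' : pdvd s (M i' j').
  case: s smin {np} => [|s] smin; first exact: pdvd0.
  apply: NNPP => H; have /smin : P s by apply/holdsP; exists i', j'.
  by rewrite ltnn.
have [//|[t [a [ts aU E]]]] := pdvd_or s.+1 (M i0 j0).
exists i0, j0, s, a; split=> //; rewrite E; congr (_ * pi ^+ _).
by have := ps i0 j0; rewrite E => /(pdvd_unit aU); lia.
Qed.

(** An entry of least valuation divides all others; moved to the corner, it clears its row and
    column in one step. *)
Lemma smith_form n (M : 'M[R]_n) : exists P Q d,
  [/\ P \in unitmx, Q \in unitmx & P *m M *m Q = diag_mx d].
Proof.
elim: n => [|n IHn] in M *.
  by exists 1%:M, 1%:M, 0; rewrite unitmx1; split=> //; apply/matrixP => -[].
have [->|M0] := eqVneq M 0.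
  by exists 1%:M, 1%:M, 0; rewrite unitmx1 mulmx0 mul0mx raddf0.
have [i [j [s [a [aU Mij Ms]]]]] := min_val_entry M0.
pose M1 : 'M[R]_(1 + n) := xrow 0 i (xcol 0 j M).
have M1s k l : pdvd s (M1 k l) by rewrite /M1 /xrow /xcol !mxE.
have M100 : M1 0 0 = a * pi ^+ s by rewrite /M1 /xrow /xcol !mxE !tpermL.
have M1E : M1 = tperm_mx 0 i *m M *m tperm_mx 0 j by rewrite /M1 xrowE xcolE mulmxA.
clearbody M1.
have [r rE] : exists r, ursubmx M1 = pi ^+ s *: r.
  have /fin_all_exists[r rP] : forall k, exists x, ursubmx M1 0 k = pi ^+ s * x.
    by move=> k; rewrite !mxE; apply: M1s.
  by exists (\row_k r k); apply/rowP => k; rewrite rP !mxE.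
have [c cE] : exists c, dlsubmx M1 = pi ^+ s *: c.
  have /fin_all_exists[c cP] : forall k, exists x, dlsubmx M1 k 0 = pi ^+ s * x.
    by move=> k; rewrite !mxE; apply: M1s.
  by exists (\col_k c k); apply/colP => k; rewrite cP !mxE.
have ulE : ulsubmx M1 = (a * pi ^+ s)%:M.
  by apply/matrixP => k l; rewrite [k]ord1 [l]ord1 !mxE !lshift0 M100 eqxx mulr1n.
pose P1 : 'M[R]_(1 + n) := block_mx 1%:M 0 (- a^-1 *: c) 1%:M.
pose Q1 : 'M[R]_(1 + n) := block_mx 1%:M (- a^-1 *: r) 0 1%:M.
(* The induction runs on the Schur complement of the corner [a * pi ^+ s]. *)
have [P2 [Q2 [d [P2U Q2U dE]]]] := IHn (drsubmx M1 - (a^-1 * pi ^+ s) *: (c *m r)).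
pose P3 : 'M[R]_(1 + n) := block_mx 1%:M 0 0 P2.
pose Q3 : 'M[R]_(1 + n) := block_mx 1%:M 0 0 Q2.
exists (P3 *m P1 *m tperm_mx 0 i), (tperm_mx 0 j *m Q1 *m Q3), (row_mx (a * pi ^+ s)%:M d);
  split.
- rewrite !unitmx_mul unitmx_perm andbT !unitmxE /P3 /P1 !(@det_lblock _ 1 n) !det1 !mul1r.
  by rewrite unitr1 andbT -unitmxE.
- rewrite !unitmx_mul unitmx_perm /= !unitmxE /Q3 /Q1 !(@det_ublock _ 1 n) !det1 !mul1r.
  by rewrite unitr1 -unitmxE.
have -> : P3 *m P1 *m tperm_mx 0 i *m M *m (tperm_mx 0 j *m Q1 *m Q3) =
    P3 *m (P1 *m M1 *m Q1) *m Q3 by rewrite M1E !mulmxA.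
rewrite -[M1]submxK ulE rE cE /P1 /Q1 /P3 /Q3 !mulmx_block.
rewrite !(mul1mx, mulmx1, mul0mx, mulmx0, addr0, add0r) (@diag_mx_row _ n 1).
have eq_block A B C D A' B' C' D' : A = A' -> B = B' -> C = C' -> D = D' ->
    @block_mx R 1 n 1 n A B C D = block_mx A' B' C' D' by move=> -> -> -> ->.
have aK : a * pi ^+ s * - a^-1 = - pi ^+ s by rewrite mulrN mulrAC divrr // mul1r.
have c0 : - a^-1 *: c *m (a * pi ^+ s)%:M + pi ^+ s *: c = 0.
  by rewrite mul_mx_scalar scalerA aK scaleNr addNr.
apply: eq_block.
- by apply/matrixP => k l; rewrite [k]ord1 [l]ord1 !mxE.
- by rewrite mul_scalar_mx scalerA aK scaleNr addNr mul0mx.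
- by rewrite c0 mulmx0.
- by rewrite c0 mul0mx add0r -scalemxAl -scalemxAr scalerA mulNr scaleNr addrC dE.
Qed.

(** If [P *m M *m Q] is diagonal, right multiplication by [Q] carries the row space of [M] to that
    of the diagonal matrix, so [G = Q]. *)
Lemma lattice_type n (L : 'rV[R]_n -> Prop) (M : 'M[R]_n) :
  (forall v, L v <-> exists c : 'rV[R]_n, v = c *m M) -> \det M != 0 ->
  exists G lam, iso_via G L lam.
Proof.
move=> LM M0; have [P [Q [d [PU QU PMQ]]]] := smith_form M.
have /fin_all_exists[lam lamP] :
    forall i, exists k, exists2 a, a \is a GRing.unit & d 0 i = a * pi ^+ k.
  move=> i; have di : d 0 i != 0.
    apply: contraNneq M0 => di.
    have: \det (diag_mx d) = 0 by rewrite det_diag (bigD1 i) //= di mul0r.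
    move/eqP; rewrite -PMQ !det_mulmx !mulf_eq0.
    move: PU QU; rewrite !unitmxE => PU QU.
    case: (eqVneq (\det P) 0) PU => [->|_ _]; first by rewrite unitr0.
    by case: (eqVneq (\det Q) 0) QU => [->|_ _]; rewrite ?unitr0 //= orbF.
  by have [_ _ /(_ _ di)[k [a [aU E]]]] := piDVR; exists k, a.
exists Q, lam; split=> [v|w]; last first.
  by exists (w *m invmx Q) => i; rewrite mulmxKV // subrr mxE; apply: pdvdx0.
apply: iff_trans (LM v) _; split=> [[c ->] i|Dv].
  have -> : c *m M *m Q = (c *m invmx P) *m diag_mx d.
    by rewrite -PMQ !mulmxA mulmxKV.
  rewrite mul_mx_diag mxE; have [a aU ->] := lamP i.
  by rewrite mulrA; apply/pdvd_mull/pdvd_pow.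
have /fin_all_exists[x xP] : forall i, exists x, (v *m Q) 0 i = x * d 0 i.
  move=> i; have [a aU ->] := lamP i; have [r ->] := Dv i.
  by exists (r * a^-1); rewrite mulrA mulrVK // mulrC.
exists ((\row_i x i) *m P); apply: (can_inj (mulmxK QU)).
rewrite -!mulmxA (mulmxA P) PMQ mul_mx_diag.
by apply/rowP => i; rewrite xP !mxE.
Qed.

Lemma hermite_type n (L : 'rV[R]_n -> Prop) b :
  hermite pi L b -> exists G lam, iso_via G L lam.
Proof.
case=> M [Mtri LM Mdiag]; apply: (lattice_type LM).
rewrite -det_tr det_trig; last first.
  by apply/is_trig_mxP => i j ij; rewrite mxE Mtri.
apply/prodf_neq0 => i _; rewrite mxE; have [a [aU ->]] := Mdiag i.
rewrite mulf_neq0 ?expf_neq0 ?pi_neq0 //.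
by apply: contraTneq aU => ->; rewrite unitr0.
Qed.

(** ** The recursion on the rank *)

Lemma seteq_equiv T : equivalence (@seteq T).
Proof.
split=> [L v|L1 L2 H v|L1 L2 L3 H12 H23 v] //; first exact: iff_sym.
exact: iff_trans (H12 v) (H23 v).
Qed.

Lemma hermite_seteq n (L1 L2 : 'rV[R]_n -> Prop) b :
  seteq L1 L2 -> hermite pi L1 b -> hermite pi L2 b.
Proof.
move=> H [M [Mtri LM Md]]; exists M; split=> // v.
exact: iff_trans (iff_sym (H v)) (LM v).
Qed.

Lemma iso_via_seteq n (G : 'M[R]_n) (L1 L2 : 'rV[R]_n -> Prop) lam :
  seteq L1 L2 -> iso_via G L1 lam -> iso_via G L2 lam.
Proof.
move=> H [LE onto]; split=> // v.
exact: iff_trans (iff_sym (H v)) (LE v).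
Qed.

(** The intersection of [L] with [0 + o^n], read in [o^n]. *)
Definition restrict n (L : 'rV[R]_(1 + n) -> Prop) (v : 'rV[R]_n) : Prop := L (row_mx 0 v).

Lemma restrict_ext n (L : 'rV[R]_n -> Prop) e u : seteq (restrict (ext L e u)) L.
Proof.
move=> v; rewrite /restrict /ext; rewrite row_mxKl row_mxKr mxE.
split=> [[c [/esym/eqP]]|Lv]; last by exists 0; rewrite mul0r scale0r subr0.
rewrite mulf_eq0 expf_eq0 (negPf pi_neq0) andbF orbF => /eqP->.
by rewrite scale0r subr0.
Qed.

Lemma ext_seteq n (L1 L2 : 'rV[R]_n -> Prop) e u :
  seteq L1 L2 -> seteq (ext L1 e u) (ext L2 e u).
Proof. by move=> H v; split=> -[c [E /H]]; exists c. Qed.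

Lemma ext_cong n (L : 'rV[R]_n -> Prop) e u1 u2 :
  subgroup L -> (forall a v, L v -> L (a *: v)) ->
  cong L u1 u2 <-> seteq (ext L e u1) (ext L e u2).
Proof.
move=> Lsub LZ; split=> [L12 v|H].
  have H w1 w2 : L (w1 - w2) -> ext L e w1 v -> ext L e w2 v.
    move=> Lw [c [E Lv]]; exists c; split=> //.
    have -> : rsubmx v - c *: w2 = (rsubmx v - c *: w1) + c *: (w1 - w2).
      by rewrite scalerBr addrA subrK.
    by apply: (subgroupD Lsub) => //; apply: LZ.
  split; apply: H => //.
  by have [_ Es _] := cong_equiv Lsub; apply: Es.
(* The generator [(pi ^+ e, u1)] must lie in the second extension; its first coordinate forces the
   multiplier to be 1. *)
have /H[c []] : ext L e u1 (row_mx (pi ^+ e)%:M u1).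
  exists 1; rewrite row_mxKl row_mxKr mxE mulr1n mul1r scale1r subrr.
  by split=> //; apply: subgroup0.
rewrite row_mxKl row_mxKr mxE mulr1n => /eqP.
rewrite -[X in X == _]mul1r -subr_eq0 -mulrBl mulf_eq0 expf_eq0 (negPf pi_neq0) andbF orbF.
by rewrite subr_eq0 => /eqP <-; rewrite scale1r.
Qed.

Lemma ext_hermite n (L : 'rV[R]_n -> Prop) (b : 'I_n.+1 -> nat) u :
  hermite pi L (tail_fun b) -> hermite pi (ext L (b ord0) u : 'rV[R]_n.+1 -> Prop) b.
Proof.
case=> M [Mtri LM Md].
exists (block_mx (pi ^+ b ord0)%:M u 0 M : 'M[R]_(1 + n)); split.
- move=> i j.
  case: (@split_ordP 1 n i) => i' ->; case: (@split_ordP 1 n j) => j' -> /=.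
  + by rewrite [i']ord1 [j']ord1.
  + by rewrite [i']ord1.
  + by rewrite (@block_mxEdl _ 1 n 1 n) mxE.
  + by rewrite !add1n ltnS (@block_mxEdr _ 1 n 1 n); apply: Mtri.
- move=> v; split=> [[c [E /LM[d Ed]]]|[c ->]].
    exists (row_mx c%:M d : 'rV[R]_(1 + n)).
    rewrite -[v in LHS](hsubmxK (v : 'rV[R]_(1 + n))) (@mul_row_block _ 1 1 n 1 n).
    rewrite mulmx0 addr0 !mul_scalar_mx -Ed [_ *: u + _]addrC subrK;
      apply: (f_equal2 (@row_mx R 1 1 n)) => //.
    by apply/rowP => i; rewrite [i]ord1 E !mxE eqxx mulr1n.
  rewrite -[c](hsubmxK (c : 'rV[R]_(1 + n))) (@mul_row_block _ 1 1 n 1 n).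
  move: (lsubmx _) (rsubmx _) => cl cr; rewrite [cl]mx11_scalar.
  exists (cl 0 0); rewrite row_mxKl row_mxKr mulmx0 addr0 !mul_scalar_mx; split.
    by rewrite !mxE eqxx mulr1n.
  by rewrite addrAC subrr add0r; apply/LM; exists cr.
- move=> i; case: (@split_ordP 1 n i) => i' ->.
    rewrite [i']ord1 (@block_mxEul _ 1 n 1 n) mxE eqxx mulr1n.
    exists 1; rewrite unitr1 mul1r; split=> //; congr (_ ^+ b _).
    exact/val_inj.
  rewrite (@block_mxEdr _ 1 n 1 n).
  have -> : rshift 1 i' = lift ord0 i' by apply/val_inj.
  exact: Md.
Qed.

Lemma hermite_ext n (L : 'rV[R]_n.+1 -> Prop) (b : 'I_n.+1 -> nat) :
  hermite pi L b ->
  hermite pi (restrict (L : 'rV[R]_(1 + n) -> Prop)) (tail_fun b) /\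
  exists u, seteq L (ext (restrict (L : 'rV[R]_(1 + n) -> Prop)) (b ord0) u).
Proof.
case=> M [Mtri LM Md]; pose M' : 'M[R]_(1 + n) := M.
have dl0 : dlsubmx M' = 0.
  by apply/matrixP => i j; rewrite !mxE; apply: Mtri; rewrite [j]ord1.
have [a [aU M00]] := Md ord0.
have ulE : ulsubmx M' = (a * pi ^+ b ord0)%:M.
  apply/matrixP => i j; rewrite [i]ord1 [j]ord1 !mxE eqxx mulr1n -M00.
  by congr (M _ _); apply/val_inj.
have mulM (xl : 'M[R]_1) (xr : 'rV[R]_n) : (row_mx xl xr : 'rV[R]_n.+1) *m M =
    row_mx (xl 0 0 * a * pi ^+ b ord0)%:M (xl 0 0 *: ursubmx M' + xr *m drsubmx M').
  rewrite -[M]/M' -[M' in LHS]submxK dl0 ulE (@mul_row_block _ 1 1 n 1 n).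
  by rewrite [xl]mx11_scalar mulmx0 addr0 !mul_scalar_mx scale_scalar_mx mulrA !mxE eqxx mulr1n.
have LE (v : 'rV[R]_(1 + n)) : L v <-> exists c, exists d : 'rV[R]_n,
    lsubmx v 0 0 = c * a * pi ^+ b ord0 /\ rsubmx v = c *: ursubmx M' + d *m drsubmx M'.
  apply: iff_trans (LM v) _; split=> [[x ->]|[c [d [E1 E2]]]].
    rewrite -[x](hsubmxK (x : 'rV[R]_(1 + n))) mulM row_mxKl row_mxKr mxE eqxx mulr1n.
    by exists (@lsubmx _ 1 1 n x 0 0), (@rsubmx _ 1 1 n x).
  exists (row_mx c%:M d : 'rV[R]_(1 + n)).
  rewrite mulM mxE eqxx mulr1n -E1 -E2 -[LHS](hsubmxK (v : 'rV[R]_(1 + n))).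
  by apply: (f_equal2 (@row_mx R 1 1 n)) => //; apply: mx11_scalar.
have resE v : restrict L v <-> exists d : 'rV[R]_n, v = d *m drsubmx M'.
  apply: iff_trans (LE _) _; rewrite row_mxKl row_mxKr mxE.
  split=> [[c [d [/esym/eqP E1 ->]]]|[d ->]]; last first.
    by exists 0, d; rewrite !mul0r scale0r add0r.
  exists d; move: E1; rewrite !mulf_eq0 expf_eq0 (negPf pi_neq0) andbF orbF.
  case/orP=> /eqP E; first by rewrite E scale0r add0r.
  by move: aU; rewrite E unitr0.
split.
  exists (drsubmx M'); split=> [i j ij|v|i]; [|exact: resE|].
    by rewrite !mxE; apply: Mtri; rewrite /= !add1n ltnS.
  rewrite !mxE; have -> : rshift 1 i = lift ord0 i by apply/val_inj.
  exact: Md.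
(* Dividing the first row by the unit [a] turns its diagonal entry into an exact power of [pi]. *)
exists (a^-1 *: ursubmx M') => v; apply: iff_trans (LE v) _.
split=> [[c [d [E1 E2]]]|[c [E1 /resE[d E2]]]].
  exists (c * a); split=> //; apply/resE; exists d.
  by rewrite E2 scalerA mulrK // addrAC subrr add0r.
exists (c * a^-1), d; split; first by rewrite mulrVK.
by rewrite -E2 scalerA addrC subrK.
Qed.

(** The type enters only through its conjugate, as a function of the column, which is the form in
    which strips are subtracted. *)
Definition lat_of n (b : 'I_n -> nat) (c : nat -> nat) (L : 'rV[R]_n -> Prop) : Prop :=
  hermite pi L b /\ exists G lam, iso_via G L lam /\ forall j, conj_type lam j = c j.

Lemma lat_of_seteq n (b : 'I_n -> nat) c (L1 L2 : 'rV[R]_n -> Prop) :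
  seteq L1 L2 -> lat_of b c L1 -> lat_of b c L2.
Proof.
move=> H [H1 [G [lam [iso lamc]]]]; split; first exact: hermite_seteq H H1.
by exists G, lam; split=> //; apply: iso_via_seteq iso.
Qed.

(** The indices of the modules [thicken L j] depend on [L] alone, and their exponents of [q] have
    the conjugate parts as increments. *)
Lemma conj_type_uniq n (G1 G2 : 'M[R]_n) L1 L2 lam1 lam2 :
  seteq L1 L2 -> iso_via G1 L1 lam1 -> iso_via G2 L2 lam2 ->
  forall j, conj_type lam1 j = conj_type lam2 j.
Proof.
move=> H iso1 /(iso_via_seteq ((let: And3 _ s _ := seteq_equiv _ in s) _ _ H)) iso2.
have E j : (\sum_i minn (lam1 i) j = \sum_i minn (lam2 i) j)%N.
  apply/eqP; rewrite -(eqn_exp2l _ _ q_gt1); apply/eqP.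
  exact: (class_count_uniq (cong_equiv (thicken_subgroup iso1 j))
    (thicken_count iso1 j) (thicken_count iso2 j)).
by move=> j; have := E j.+1; rewrite !sum_minnS E => /addnI.
Qed.

Lemma sum_fun_of_ord l (th : 'I_l -> bool) k : (l <= k)%N ->
  partial (fun_of_ord th) k = (\sum_j th j)%N.
Proof.
move=> lk; rewrite /partial.
have -> : (\sum_j th j = \sum_(j < l) fun_of_ord th j)%N.
  by apply: eq_bigr => j _; rewrite fun_of_ordE.
rewrite (big_ord_widen k (fun j => nat_of_bool (fun_of_ord th j)) lk) big_mkcond /=.
rewrite [RHS]big_mkcond; apply: eq_bigr => j _ /=.
by case: ifP => //; rewrite /fun_of_ord; case: insubP => [i ->|].
Qed.

Lemma strip_wt_ext l Y c c' th : (forall j, c j = c' j) ->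
  strip_wt l Y c th = strip_wt l Y c' th.
Proof.
by move=> E; rewrite /strip_wt; congr (_ * _); apply: eq_bigr => j _; rewrite !E.
Qed.

(** The lattices with restriction [L] and first Hermite exponent [b ord0] are the extensions of [L],
    one for each class of [u] modulo [L]; the condition on the type becomes the level condition of
    [strip_count]. *)
Lemma fiber_count n (L : 'rV[R]_n -> Prop) (b : 'I_n.+1 -> nat) c l (th : {ffun 'I_l -> bool}) :
  (forall j, (l <= j)%N -> c j = 0%N) ->
  (b ord0 = \sum_j th j)%N -> (forall j : 'I_l, th j <= c j)%N ->
  lat_of (tail_fun b) (fun j => c j - fun_of_ord th j)%N L ->
  exists k, class_count (@seteq 'rV[R]_n.+1)
      (fun K => lat_of b c K /\ seteq (restrict (K : 'rV[R]_(1 + n) -> Prop)) L) k /\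
    (k%:R : rat) = strip_wt l q%:R^-1 (fun j => c j - fun_of_ord th j)%N (fun_of_ord th).
Proof.
move=> c0 be thc [hL [G [mu [iso muc]]]].
have cE j : (c j = conj_type mu j + fun_of_ord th j)%N.
  rewrite muc subnK //; rewrite /fun_of_ord; case: insubP => [i _ <-|//]; exact: thc.
have mul i : (mu i <= l)%N.
  rewrite leqNgt; apply/negP => lt; have := cE l.
  by rewrite c0 // /conj_type (bigD1 i) //= lt.
have [k [ck kE]] := strip_count iso mul (fun k => @sum_fun_of_ord l th k).
exists k; split; last by rewrite kE; apply: strip_wt_ext.
rewrite -be in ck.
have Lsub := iso_subgroup iso.
apply: (class_count_push (phi := fun u => ext L (b ord0) u : 'rV[R]_n.+1 -> Prop)) ck.
- exact: seteq_equiv.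
- by move=> x y _ _; apply: ext_cong => // a v; apply: isoZ iso _ _.
- move=> u lev; split; last exact: restrict_ext.
  have hK := ext_hermite u hL; split=> //.
  have [G' [lam iso']] := hermite_type hK; exists G', lam; split=> // j.
  by rewrite cE; move: j; apply/(ext_conj_type iso iso').
- move=> K [[hK [G' [lam [iso' lamc]]]] KL].
  have [_ [u Ku]] := hermite_ext hK.
  have Ku' : seteq K (ext L (b ord0) u).
    by have [_ _ Et] := seteq_equiv 'rV[R]_n.+1; apply: Et Ku (ext_seteq _ _ KL).
  exists u => //; apply/(ext_conj_type iso (iso_via_seteq Ku' iso')) => j.
  by rewrite lamc cE.
Qed.

(** Lattices are sorted by the strip between their type and that of their restriction. For a fixed
    strip, restriction has fibres of constant size over the lattices counted by [N]. *)
Lemma lat_of_step n (b : 'I_n.+1 -> nat) c l (N : (nat -> nat) -> rat) :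
  (forall j, (l <= j)%N -> c j = 0%N) ->
  (forall c', (forall j, (l <= j)%N -> c' j = 0%N) ->
     exists k, class_count (@seteq 'rV[R]_n) (lat_of (tail_fun b) c') k /\ k%:R = N c') ->
  exists k, class_count (@seteq 'rV[R]_n.+1) (lat_of b c) k /\
    (k%:R : rat) = \sum_(th : {ffun 'I_l -> bool} |
      (b ord0 == \sum_j th j)%N && [forall j : 'I_l, th j <= c j]%N)
    strip_wt l q%:R^-1 (fun j => c j - fun_of_ord th j)%N (fun_of_ord th) *
    N (fun j => c j - fun_of_ord th j)%N.
Proof.
move=> c0 IH.
pose ok (th : {ffun 'I_l -> bool}) :=
  (b ord0 == \sum_j th j)%N && [forall j : 'I_l, th j <= c j]%N.
pose c_ (th : {ffun 'I_l -> bool}) j := (c j - fun_of_ord th j)%N.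
pose Q th (K : 'rV[R]_n.+1 -> Prop) := [/\ ok th, lat_of b c K &
  lat_of (tail_fun b) (c_ th) (restrict (K : 'rV[R]_(1 + n) -> Prop))].
have cnt th : exists k, class_count (@seteq 'rV[R]_n.+1) (Q th) k /\
    (k%:R : rat) = if ok th then strip_wt l q%:R^-1 (c_ th) (fun_of_ord th) * N (c_ th) else 0.
  case: ifP => [okth|nok]; last first.
    by exists 0%N; split=> //; apply: class_count0 => K []; rewrite nok.
  have [k' [ck' <-]] : exists k, class_count (@seteq 'rV[R]_n) (lat_of (tail_fun b) (c_ th)) k /\
      (k%:R : rat) = N (c_ th) by apply: IH => j lj; rewrite /c_ c0.
  have [/eqP be /forallP thc] := andP okth.
  (* The fibre size is read off from one lattice [L0]; if there is none, both sides vanish. *)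
  have [[L0 hL0]|none] := classic (exists L, lat_of (tail_fun b) (c_ th) L); last first.
    have c00 : class_count (@seteq 'rV[R]_n) (lat_of (tail_fun b) (c_ th)) 0.
      by apply: class_count0 => L hL; apply: none; exists L.
    rewrite (class_count_uniq (seteq_equiv _) ck' c00) mulr0; exists 0%N; split=> //.
    by apply: class_count0 => K [_ _ hK]; apply: none;
      exists (restrict (K : 'rV[R]_(1 + n) -> Prop)).
  have [k [_ kE]] := fiber_count c0 be thc hL0.
  exists (k' * k)%N; split; last by rewrite natrM kE mulrC.
  apply: (class_count_fiber (p := fun K => restrict (K : 'rV[R]_(1 + n) -> Prop))) ck'.
  - exact: seteq_equiv.
  - by move=> K [].
  - by move=> K K' H v; apply: H.
  (* The size is the same over every [L], as its rational value depends on the strip only. *)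
  - move=> L hL; have [k2 [ck2 k2E]] := fiber_count c0 be thc hL.
    have -> : k = k2 by apply/eqP; rewrite -(eqr_nat rat) kE k2E.
    apply: class_count_ext ck2 => K; split=> [[hK KL]|[[_ hK _] KL]] //.
    split=> //; split=> //; apply: lat_of_seteq hL.
    by have [_ Es _] := seteq_equiv 'rV[R]_n; apply: Es.
have [k kP] := functional_choice cnt.
exists (\sum_th k th)%N; split; last first.
  rewrite natr_sum [RHS]big_mkcond; apply: eq_bigr => th _.
  by have [_ ->] := kP th.
apply: (class_count_sum (Qi := Q)); last by move=> th; case: (kP th).
- move=> K; split=> [hK|[th []//]].
  have [herm [G' [lam [iso' lamc]]]] := hK.
  have [hres [u Ku]] := hermite_ext herm.
  have [G [mu iso]] := hermite_type hres.
  have iso2 := iso_via_seteq Ku iso'.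
  have [th thE] := ext_strip_ex iso iso2.
  have lam0 j : (l <= j)%N -> conj_type lam j = 0%N by rewrite lamc; apply: c0.
  pose th' := [ffun j : 'I_l => th j].
  have th'E j : fun_of_ord th' j = th j.
    rewrite /fun_of_ord; case: insubP => [i _ <-|]; first by rewrite ffunE.
    rewrite -leqNgt => /lam0; rewrite thE => /eqP; rewrite addn_eq0 => /andP[_].
    by case: (th j).
  exists th'; split=> //.
    rewrite /ok -(@sum_fun_of_ord l th' l) // (_ : partial _ _ = partial th l).
      rewrite (ext_strip_size iso iso2 thE lam0) // eqxx.
      by apply/forallP => j; rewrite ffunE -lamc thE leq_addl.
    by apply: eq_bigr => j _; rewrite th'E.
  split=> //; exists G, mu; split=> // j.
  by rewrite /c_ -lamc thE th'E addnK.
(* The type of the restriction determines the strip, because [th j <= c j] makes the subtraction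
   exact. *)
- move=> th th' K K' [ok1 _ [_ [G1 [mu1 [iso1 E1]]]]] [ok2 _ [_ [G2 [mu2 [iso2 E2]]]]] KK'.
  apply/ffunP => j.
  have := conj_type_uniq (fun v => KK' _) iso1 iso2 j.
  rewrite E1 E2 /c_ !fun_of_ordE.
  have [_ /forallP/(_ j)] := andP ok1; have [_ /forallP/(_ j)] := andP ok2.
  by case: (th j) (th' j) => -[] /=; lia.
Qed.

Theorem lattice_count n (b : 'I_n -> nat) c l :
  (forall j, (l <= j)%N -> c j = 0%N) ->
  exists k, class_count (@seteq 'rV[R]_n) (lat_of b c) k /\
    (k%:R : rat) = tab_sum l q%:R^-1 c b.
Proof.
elim: n => [|n IHn] in b c *; last first.
  move=> c0; rewrite tab_sumS ?invr_eq0 //.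
  apply: (lat_of_step (N := fun c' => tab_sum l q%:R^-1 c' (tail_fun b)) c0) => c' c'0.
  exact: IHn.
move=> c0; rewrite tab_sum0.
have v0 (v : 'rV[R]_0) : v = 0 by apply/rowP => -[].
have conj0 (lam : 'I_0 -> nat) j : conj_type lam j = 0%N by rewrite /conj_type big_ord0.
case: ifP => [/forallP cl|/forallP ncl].
  have cE j : c j = 0%N by have [/c0//|lj] := leqP l j; apply/eqP/(cl (Ordinal lj)).
  (* In rank 0 there is a single lattice, and its type has no boxes. *)
  exists 1%N; split=> //.
  exists (fun _ _ => True); split=> [_|K [[M [_ KE _]] _]|i j _];
    last by rewrite [i]ord1 [j]ord1.
    split; first by exists 0; split=> [[]|v|[]] //; split=> // _; exists 0; apply/rowP => -[].
    exists 0, (fun=> 0%N); split=> [|j]; last by rewrite conj0 cE.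
    by split=> [v|w]; [split=> // _ []|exists 0; case].
  exists ord0 => v; split=> // _; apply/KE; exists 0; rewrite mul0mx; exact: v0.
exists 0%N; split=> //; apply: class_count0 => K [_ [G [lam [_ lamc]]]].
by case: ncl => j; rewrite -lamc conj0.
Qed.

(** * From conjugate types to the coefficients of the Hermite-Smith series *)

(** The multiplicity of a value is a difference of two counts of larger parts, so equal conjugates
    mean equal multisets. *)
Lemma conj_type_perm n (mu lam : 'I_n -> nat) :
  (forall j, conj_type mu j = conj_type lam j) -> exists s : 'S_n, forall i, lam i = mu (s i).
Proof.
move=> E; have cntE (f : 'I_n ->
  nat) j : count (fun x => j < x)%N [tuple f i | i < n] = conj_type f j.
  by rewrite -sum1_count big_mkcond big_tuple; apply: eq_bigr => i _; rewrite tnth_mktuple;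
    case: ltnP.
have pe : perm_eq [tuple lam i | i < n] [tuple mu i | i < n].
  apply/allP => x _ /=; apply/eqP.
  have cnt_split (r : seq nat) :
      (count_mem x r + count (fun y => x < y) r = count (fun y => x <= y) r)%N.
    by elim: r => //= y r <-; case: (ltngtP x y); lia.
  have ge_eq : count (fun y => x <= y)%N [tuple lam i | i < n] =
      count (fun y => x <= y)%N [tuple mu i | i < n].
    case: (x) => [|x']; last by rewrite !cntE.
    by rewrite !(eq_count (a2 := predT)) // !count_predT !size_tuple.
  by move: ge_eq; rewrite -!cnt_split !cntE E => /addIn.
have /tuple_permP[s sE] := pe; exists s => i.
have: nth 0%N [tuple lam i | i < n] i = nth 0%N [tuple tnth [tuple mu i | i < n] (s i) | i < n] i.
  by rewrite -sE.
by rewrite -!tnth_nth !tnth_mktuple.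
Qed.

Lemma iso_via_lattice n (G : 'M[R]_n) (L : 'rV[R]_n -> Prop) lam :
  iso_via G L lam -> is_lattice L.
Proof.
move=> iso; have Lsub := iso_subgroup iso; split.
- exact: subgroup0 Lsub.
- by move=> u v; apply: (subgroupD Lsub).
- by move=> r u; apply: (isoZ iso).
have [||f [_ cov _]] := iso_pull iso (diag_subgroup lam) _ _ (diag_count_all lam) => //.
exists (codom f) => v; have [i Ei] := cov v I; exists (f i); split; first exact: codom_f.
by have [LE _] := iso; apply/LE.
Qed.

Lemma getn_ord n (lam : 'I_n -> nat) (i : 'I_n) : getn lam i = lam i.
Proof. by rewrite /getn valK. Qed.

Lemma getn_oversize n (lam : 'I_n -> nat) k : (n <= k)%N -> getn lam k = 0%N.
Proof. by move=> nk; rewrite /getn insubF // ltnNge nk. Qed.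

Lemma tail_sum_oversize n (a : 'I_n -> nat) k : (n <= k)%N -> tail_sum a k = 0%N.
Proof.
move=> nk; rewrite /tail_sum big_pred0 // => i.
by rewrite leqNgt (leq_trans (ltn_ord i) nk).
Qed.

Lemma inc_tail_sum n (a : 'I_n -> nat) i : inc (fun i : 'I_n => tail_sum a i) i = a i.
Proof.
rewrite /inc tail_sumS; suff -> : getn (fun i : 'I_n => tail_sum a i) i.+1 = tail_sum a i.+1.
  by rewrite addnK.
have [lt|ge] := ltnP i.+1 n; first exact: (getn_ord _ (Ordinal lt)).
by rewrite getn_oversize // tail_sum_oversize.
Qed.

(** Downward induction from [k >= n], where both sides are 0; monotonicity makes the subtraction in
    [inc] exact. *)
Lemma partition_tail_sum n (a lam : 'I_n -> nat) :
  is_partition lam -> (forall i, inc lam i = a i) -> forall i, lam i = tail_sum a i.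
Proof.
move=> part lama; suff H k : getn lam k = tail_sum a k by move=> i; rewrite -getn_ord H.
have [m] := ubnP (n - k); elim: m k => // m IHm k; rewrite ltnS => nk.
have [lt|ge] := ltnP k n; last by rewrite getn_oversize // tail_sum_oversize.
have IH : getn lam k.+1 = tail_sum a k.+1 by apply: IHm; lia.
rewrite -[k]/(val (Ordinal lt)) getn_ord tail_sumS -lama /inc -IH /= subnK //.
have [lt'|ge'] := ltnP k.+1 n; last by rewrite getn_oversize.
by rewrite -[k.+1]/(val (Ordinal lt')) getn_ord; apply: part; apply: leqnSn.
Qed.

Lemma HS_term_lat_of n (a b : 'I_n -> nat) L :
  HS_term pi a b L <-> lat_of b (conj_type (fun i : 'I_n => tail_sum a i)) L.
Proof.
split=> [[_ [lam [[part [G iso]] lama]] herm]|[herm [G [mu [iso muc]]]]].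
  split=> //; exists G, lam; split=> // j; apply: eq_bigr => i _.
  by rewrite (partition_tail_sum part lama).
split=> //; first exact: iso_via_lattice iso.
exists (fun i : 'I_n => tail_sum a i); split; last exact: inc_tail_sum.
split; first by move=> i j; apply: tail_sum_mono.
have [s sE] := conj_type_perm muc; have [LE onto] := iso.
have permE (v : 'rV[R]_n) i : (v *m col_perm s G) 0 i = (v *m G) 0 (s i).
  by rewrite !mxE; apply: eq_bigr => k _; rewrite mxE.
(* Permuting the columns of [G] puts the parts of the type into decreasing order. *)
exists (col_perm s G); split=> [v|w].
  apply: iff_trans (LE v) _; split=> H i.
    by rewrite permE sE; apply: H.
  by have := H (s^-1 i)%g; rewrite permE sE permKV.
have [v Dv] := onto (col_perm s^-1 w); exists v => i.
have := Dv (s i); rewrite sE mxE [col_perm _ _ _ _]mxE permK.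
by rewrite [(w - _) 0 i]mxE ![(- _ : 'M__) _ _]mxE permE.
Qed.
End DVR.

Lemma class_count_HS_coef (R : idomainType) (pi : R) n (a b : 'I_n -> nat) k :
  class_count (@seteq 'rV[R]_n) (HS_term pi a b) k -> HS_coef_is pi a b k.
Proof.
case=> f [fQ fE fI]; exists [seq f i | i <- enum 'I_k].
have nthf (i : 'I_k) : nth (fun=> False) [seq f i | i <- enum 'I_k] i = f i.
  by rewrite (nth_map i) ?size_enum_ord // nth_ord_enum.
have In_map (s : seq 'I_k) i : i \in s -> List.In (f i) [seq f i | i <- s].
  by elim: s => //= j s IHs; rewrite inE => /orP[/eqP->|/IHs]; [left|right].
split.
- by rewrite size_map size_enum_ord.
- by move=> L; elim: (enum 'I_k) => //= i s IHs [<-|/IHs].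
- by move=> L /fE[i Ei]; exists (f i) => //; apply: In_map; rewrite mem_enum.
- move=> i j ik jk ij; rewrite -[i]/(val (Ordinal ik)) -[j]/(val (Ordinal jk)) !nthf.
  by move=> /fI E; apply: ij; apply: (congr1 val E).
Qed.

Theorem theoremD (R : idomainType) (pi : R) (q n : nat) :
  compact_DVR pi -> residue_card pi q ->
  forall a b : 'I_n -> nat,
    exists c : nat,
      HS_coef_is pi a b c /\
      (c%:R : rat) =
        HLS_subst_coef (q%:R)^-1 (fun C => (q%:R : rat) ^ sigma C) (@xexp n) (@yexp n) a b.
Proof.
move=> [piDVR _] resq a b.
(* The largest part is the sum of all [a k], so this many columns suffice. *)
have c0 j : (\sum_k a k <= j)%N -> conj_type (fun i : 'I_n => tail_sum a i) j = 0%N.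
  move=> lj; rewrite /conj_type big1 // => i _; rewrite ltnNge.
  by rewrite (leq_trans _ lj) // (tail_sum_mono a (leq0n i)).
have [c [cL cE]] := lattice_count piDVR resq b c0.
exists c; split.
  apply: class_count_HS_coef; apply: class_count_ext cL => L.
  exact: (iff_sym (HS_term_lat_of piDVR resq a b L)).
by rewrite cE -HLS_subst_coef_tab_sum invrK.
Qed.
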